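(* Let $n,k\ge 1$ and $m\ge 0$ be integers. The set of oscillating tableaux of length $n$ with height bounded by $k$ that start at the empty partition and end at the one-row shape $\lambda=(m)$ is in bijection with the set of standard Young tableaux of size $n$ with height at most $2k$ having exactly $m$ columns of odd length.
   Context: Partitions are identified with their Ferrers diagrams; the height of a diagram is its number of rows. An oscillating tableau of length $n$ is a sequence $(\lambda^{(0)},\lambda^{(1)},\dots,\lambda^{(n)})$ of Ferrers diagrams with $\lambda^{(0)}=\varnothing$ such that each $\lambda^{(i+1)}$ is obtained from $\lambda^{(i)}$ by adding exactly one box or deleting exactly one box. It has height bounded by $k$ if no diagram in the sequence has more than $k$ rows. The shape $(0)$ is the empty shape. *)

(* Defs.v *)
From mathcomp Require Import all_boot.

Set Implicit Arguments.
Unset Strict Implicit.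
Unset Printing Implicit Defensive.

(** A Ferrers diagram is the sequence of its row lengths, without zero rows. *)
Definition is_partition (la : seq nat) : bool :=
  sorted geq la && all (ltn 0) la.

Definition height (la : seq nat) : nat := size la.

(** [one_row 0] is the empty shape. *)
Definition one_row (m : nat) : seq nat := nseq (0 < m) m.

(** [i = size la] is the creation of a new row. *)
Definition add_box (la mu : seq nat) : bool :=
  [exists i : 'I_(size la).+1, mu == incr_nth la i].

Definition osc_step (la mu : seq nat) : bool := add_box la mu || add_box mu la.

Definition is_oscillating_tableau (n : nat) (s : seq (seq nat)) : bool :=
  [&& size s == n.+1, all is_partition s, head [::] s == [::]
    & sorted osc_step s].

Definition osc_height_le (k : nat) (s : seq (seq nat)) : bool :=
  all (fun la => height la <= k) s.

Definition oscillating_tableaux (n k m : nat) : Type :=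
  {s : seq (seq nat) |
    [&& is_oscillating_tableau n s, osc_height_le k s
      & last [::] s == one_row m]}.

(** A tableau is the sequence of its rows, the longest row first;
    [shape T] is the sequence of its row lengths. *)
Definition column (T : seq (seq nat)) (j : nat) : seq nat :=
  [seq nth 0 r j | r <- T & j < size r].

Definition columns (T : seq (seq nat)) : seq (seq nat) :=
  [seq column T j | j <- iota 0 (size (head [::] T))].

Definition is_standard_tableau (n : nat) (T : seq (seq nat)) : bool :=
  [&& is_partition (shape T), perm_eq (flatten T) (iota 1 n),
      all (sorted ltn) T & all (sorted ltn) (columns T)].

Definition odd_columns (T : seq (seq nat)) : nat :=
  count (fun c => odd (size c)) (columns T).

Definition standard_tableaux (n h m : nat) : Type :=
  {T : seq (seq nat) |
    [&& is_standard_tableau n T, height (shape T) <= h & odd_columns T == m]}.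

(* Main.v *)
Require Import Defs.
From mathcomp Require Import all_boot.
From mathcomp Require Import zify.

(** Both sides are encoded by partial matchings of [{0, ..., n-1}] with [m] open
    points, through two growth diagrams in Fomin's edge-label form: a label [x]
    meeting an equal label turns both into [x + 1], and a point of the matching
    creates labels 1.

    Reading an oscillating tableau, an added box opens a point labelled by the
    column of the box, and a removed box is un-inserted, which closes an open
    point. The end shape [(m)] means that the [m] points left open carry the
    labels [1, ..., m] in order, that is, their arcs to the right are pairwise
    crossing; and the height of the diagram at time [t] (the number of labels 1)
    is the maximal nesting of arcs above [t], so that the height stays below [k]
    iff there is no [k+1]-nesting.

    Reading the same matching as a symmetric permutation matrix, Robinson-
    Schensted yields a tableau with even columns, with blanks at the open
    points. Inserting at the blanks from left to right adds a horizontal strip of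
    size [m], which creates exactly [m] odd columns, and is reversible. By
    Schensted's theorem (proved level by level as in Viennot's shadow
    construction) its number of rows is the length of a longest decreasing chain
    of the symmetric matrix, and a chain of [2k+1] points contains a
    [k+1]-nesting and conversely.

    Words and matchings are lists with the latest entry first; the position of an
    entry is the length of the list after it. *)

Set Implicit Arguments.
Unset Strict Implicit.
Unset Printing Implicit Defensive.

(** * Insertion into words with blanks *)

Fixpoint blanks (s : seq nat) : seq nat :=
  if s is x :: s' then
    if x == 0 then size s' :: blanks s' else blanks s'
  else [::].

(** Schensted row insertion on the word that records the row of each position: [p] enters row 1, the
    next entry of row 1 to its right is bumped to row 2, and so on. The second component is the row
    of the new box. *)
Fixpoint insert (p : nat) (s : seq nat) : seq nat * nat :=
  if s is x :: s' then
    if p == size s' then (1 :: s', 1) else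
    let: (t, v) := insert p s' in
    if x == v then (v.+1 :: t, v.+1) else (x :: t, v)
  else ([::], 0).

(** Reverse bumping: the last entry of row [v] moves up one row and displaces the nearest earlier
    entry there, until an entry leaves row 1 and its position becomes blank. *)
Fixpoint uninsert (v : nat) (s : seq nat) : seq nat * nat :=
  if s is x :: s' then
    if x == v then
      if v == 1 then (0 :: s', size s') else
      let: (t, p) := uninsert v.-1 s' in (v.-1 :: t, p)
    else let: (t, p) := uninsert v s' in (x :: t, p)
  else ([::], 0).

(** Index 0 is left out because the label 0 stands for a blank. *)
Definition part (f : nat -> nat) : Prop :=
  forall r, 0 < r -> f r.+1 <= f r.

Definition cnt (s : seq nat) (r : nat) : nat := count_mem r s.

Arguments cnt : simpl never.

Fixpoint lattice (s : seq nat) : Prop :=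
  if s is x :: s' then part (cnt s) /\ lattice s' else True.

Lemma cnt_cons x s r : cnt (x :: s) r = (x == r) + cnt s r.
Proof. by []. Qed.

Lemma lattice_part s : lattice s -> part (cnt s).
Proof. by case: s => [|x s] => [_ r|[]]. Qed.

Lemma blanks_lt s p : p \in blanks s -> p < size s.
Proof.
elim: s => [|x s IH] //=; case: eqP => _ /=; rewrite ?inE.
  by case/orP=> [/eqP->//|/IH]; lia.
by move/IH; lia.
Qed.

Lemma mem_blanks_cons x s p :
  (p \in blanks (x :: s)) = (x == 0) && (p == size s) || (p \in blanks s).
Proof. by rewrite /=; case: eqP => //= _; rewrite ?inE. Qed.

Lemma blanks_size_notin s : size s \in blanks s = false.
Proof. by apply/negP => /blanks_lt; lia. Qed.

Lemma blanksP x s p : p \in blanks (x :: s) ->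
  (x = 0 /\ p = size s) \/ [/\ p \in blanks s, p < size s & (p == size s) = false].
Proof.
rewrite mem_blanks_cons => /orP[/andP[/eqP-> /eqP->]|H]; first by left.
by right; have := blanks_lt H; split=> //; lia.
Qed.

Lemma insert_size p s : size (insert p s).1 = size s.
Proof.
elim: s => [|x s] //=; case: eqP => //= _.
by case: insert => t v /= <-; case: eqP.
Qed.

Lemma insert_gt0 p s : p \in blanks s -> 0 < (insert p s).2.
Proof.
elim: s => [|x s IH] // /blanksP[[-> ->]|[/IH + _ E]] /=; first by rewrite eqxx.
by rewrite E; case: insert => t v /=; case: eqP.
Qed.

Lemma mem_blanks_insert p s q : p \in blanks s ->
  (q \in blanks (insert p s).1) = (q \in blanks s) && (q != p).
Proof.
elim: s => [|x s IH] // /blanksP[[-> ->]|[Hp lp E]] /=.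
  rewrite eqxx mem_blanks_cons /= inE.
  by case: eqP => [->|_]; rewrite ?blanks_size_notin ?andbT ?andbF.
rewrite E; have := IH Hp; have := insert_gt0 Hp; have := insert_size p s.
case: insert => t v /= st v0 {}IH; case: eqP => [xv|_] /=.
  by rewrite xv IH; case: v v0 {IH xv}.
case: eqP => // _; rewrite !inE IH st.
by case: eqP => [->|_] //=; rewrite eq_sym E.
Qed.

Lemma cnt_insert p s r : p \in blanks s -> 0 < r ->
  cnt (insert p s).1 r = cnt s r + ((insert p s).2 == r).
Proof.
move=> Hp r0; elim: s Hp => [|x s IH] // /blanksP[[-> ->]|[/[dup] Hp /IH + _ E]] /=.
  by rewrite eqxx /= !cnt_cons; lia.
rewrite E; case: insert => t v /= {}IH; rewrite !cnt_cons.
by case: eqP => [->|_] /=; rewrite !cnt_cons IH; lia.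
Qed.

Lemma uninsertK p s : p \in blanks s ->
  uninsert (insert p s).2 (insert p s).1 = (s, p).
Proof.
elim: s => [|x s IH] // /blanksP[[-> ->]|[/[dup] Hp /IH + _ E]] /=.
  by rewrite eqxx.
rewrite E; have := insert_gt0 Hp; case: insert => t v /= v0 {}IH.
case: eqP => [->|/eqP/negPf xv] /=; last by rewrite xv IH.
by rewrite eqxx eqSS -(negbK (v == 0)) -lt0n v0 /= IH.
Qed.

Lemma lattice_insert p s : p \in blanks s -> lattice s ->
  lattice (insert p s).1.
Proof.
elim: s => [|x s IH] // /blanksP[[-> ->]|[Hp _ E]] [ps ls] /=.
  rewrite eqxx /=; split=> // r r0; have := ps r r0; rewrite !cnt_cons; lia.
have := IH Hp ls; have cE r := @cnt_insert _ _ r Hp.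
have := insert_gt0 Hp; rewrite E; move: cE; case: insert => t v /= cE v0 lt.
have pt := lattice_part lt; have pss := lattice_part ls.
case: (x =P v) => [xv|xv]; split=> //= r r0; rewrite !cnt_cons !cE //;
  have := ps r r0; have := pt r r0; have := pss r r0; rewrite !cnt_cons !cE //; lia.
Qed.

(** The hypothesis makes the end of row [v] a corner. If the head of the word is this corner, the
    lattice condition at the head gives a corner in row [v.-1] of the rest, from which the bumping
    continues. *)
Lemma uninsertP v s : lattice s -> 0 < v -> cnt s v.+1 < cnt s v ->
  let t := (uninsert v s).1 in let p := (uninsert v s).2 in
  [/\ p \in blanks t, insert p t = (s, v) & lattice t].
Proof.
elim: s v => [|x s IH] v //= [ps ls] v0 cv.
have pss := lattice_part ls.
case: (x =P v) => [xv|xv].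
  subst x; case: (v =P 1) => [v1|v1] /=.
    rewrite eqxx inE eqxx v1; split=> //; split=> // r r0.
    by have := pss r r0; rewrite !cnt_cons; lia.
  have v1' : 0 < v.-1 by lia.
  have [|] := IH v.-1 ls v1'.
    by have := ps v.-1 v1'; rewrite !cnt_cons prednK //; lia.
  case: uninsert => t p /= Hp Hi lt.
  have E : (p == size t) = false by have := blanks_lt Hp; lia.
  have -> : (v.-1 == 0) = false by lia.
  rewrite E Hi eqxx prednK //; split=> //; split=> // r r0.
  have := cnt_insert Hp r0; have := @cnt_insert _ _ r.+1 Hp isT; rewrite Hi /= => e1 e2.
  by have := pss r r0; rewrite !cnt_cons; lia.
have [|] := IH v ls v0; first by move: cv; rewrite !cnt_cons; lia.
case: uninsert => t p /= Hp Hi lt.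
have E : (p == size t) = false by have := blanks_lt Hp; lia.
rewrite E Hi; have /eqP/negPf -> := xv.
split=> //; first by case: eqP => _ //; rewrite inE Hp orbT.
split=> // r r0.
have := cnt_insert Hp r0; have := @cnt_insert _ _ r.+1 Hp isT; rewrite Hi /= => e1 e2.
have := ps r r0; move: cv; rewrite !cnt_cons.
case: (r =P v) => [rv|rv]; [subst r|]; lia.
Qed.

(** The row bumping lemma. The label of the second insertion could overtake that of the first only
    at an entry that the first one has already bumped. *)
Lemma insert_twice_lt p q s t v : p \in blanks s -> insert p s = (t, v) ->
  q \in blanks t -> p < q -> (insert q t).2 <= v.
Proof.
elim: s t v => [|x s IH] t v // /blanksP[[-> ->]|[Hp _ E]] /=.
  rewrite eqxx => -[<- <-] /=; move/blanks_lt => /=; lia.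
rewrite E; have := IH _ _ Hp; have := insert_size p s; have := insert_gt0 Hp.
case: insert => t' v' /= v0 st {}IH; have {}IH := IH _ _ erefl.
case: (x =P v') => [xv|xv] [<- <-] /blanksP[[] // x0 ->|[Hq _ Eq]] pq /=.
- rewrite Eq; have := IH Hq pq; case: insert => t2 v2 /= H.
  by case: eqP => /=; lia.
- by rewrite eqxx.
- rewrite Eq; have := IH Hq pq; case: insert => t2 v2 /= H.
  by case: eqP => /=; lia.
Qed.

(** The other half of the row bumping lemma: the second path crosses the new 1 at [p], leaves it
    with a label above 1, and stays ahead from there on. *)
Lemma insert_twice_gt p q s t v : p \in blanks s -> insert p s = (t, v) ->
  q \in blanks t -> q < p -> v < (insert q t).2.
Proof.
elim: s t v => [|x s IH] t v // /blanksP[[-> ->]|[Hp _ E]] /=.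
  rewrite eqxx => -[<- <-] /= Hq qs; rewrite (_ : (q == size s) = false); last lia.
  have := insert_gt0 Hq; case: insert => t2 v2 /= H; case: eqP => /=; lia.
rewrite E; have := IH _ _ Hp; have := insert_size p s; have := insert_gt0 Hp.
case: insert => t' v' /= v0 st {}IH; have {}IH := IH _ _ erefl.
case: (x =P v') => [xv|xv] [<- <-] /blanksP[[] // x0 qE|[Hq _ Eq]] pq /=.
- rewrite Eq; have := IH Hq pq; case: insert => t2 v2 /= H.
  by case: eqP => /=; lia.
- by have := blanks_lt Hp; lia.
- rewrite Eq; have := IH Hq pq; case: insert => t2 v2 /= H.
  by case: eqP => /=; lia.
Qed.

(** * Matchings and words with even columns *)

(** The label [v.+1] comes from the diagonal cell of the symmetric matrix, where the row and the
    column of the closer meet with the same label [v]. *)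
Fixpoint rsk (c : seq (option nat)) : seq nat :=
  if c is x :: c' then
    if x is Some p then
      let: (t, v) := insert p (rsk c') in v.+1 :: t
    else 0 :: rsk c'
  else [::].

Fixpoint matching (c : seq (option nat)) : bool :=
  if c is x :: c' then
    (if x is Some p then p \in blanks (rsk c') else true) && matching c'
  else true.

Definition even_columns (s : seq nat) : Prop :=
  forall r, odd r -> cnt s r.+1 = cnt s r.

Lemma rsk_size c : size (rsk c) = size c.
Proof.
elim: c => [|[p|] c IH] //=; last by rewrite IH.
by have := insert_size p (rsk c); case: insert => t v /= ->; rewrite IH.
Qed.

(** An even row [v] can receive a box only if row [v.-1] was longer than row [v], and then the
    hypothesis would give [v <= v.-1]. *)
Lemma insert_even_odd p s : p \in blanks s -> lattice s ->
  (forall r, odd r -> cnt s r.+1 < cnt s r -> (insert p s).2 <= r) ->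
  odd (insert p s).2.
Proof.
move=> Hp ls H; have v0 := insert_gt0 Hp; have lt := lattice_insert Hp ls.
have ci r := @cnt_insert p s r Hp.
case: (boolP (odd _)) => // ev; set v := (insert p s).2 in ev H v0 ci *.
have ov : odd v.-1 by case: (v) v0 ev => //= n _; rewrite negbK.
have v1 : 0 < v.-1 by case: (v.-1) ov.
have := lattice_part lt v1; rewrite !ci //.
have := H _ ov; rewrite prednK // => H1 H2.
have : v <= v.-1 by apply: H1; lia.
lia.
Qed.

(** Each closer adds a box to an odd row and another one to the row just below, so columns stay
    even. *)
Lemma rsk_lattice c : matching c -> lattice (rsk c) /\ even_columns (rsk c).
Proof.
elim: c => [|[p|] c IH] //=; last first.
  move=> /IH[lc ec]; split.
    split=> // r r0; have := lattice_part lc r0; rewrite !cnt_cons; lia.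
  by move=> r ro; rewrite !cnt_cons ec //; lia.
move=> /andP[Hp /IH[lc ec]].
have v0 := insert_gt0 Hp; have lt := lattice_insert Hp lc.
have ci r := @cnt_insert p (rsk c) r Hp.
have : odd (insert p (rsk c)).2.
  by apply: insert_even_odd => // r ro; rewrite ec // ltnn.
case: insert ci v0 lt => t v /= ci v0 lt ov.
split.
  split=> // r r0; rewrite !cnt_cons !ci //.
  have := lattice_part lc r0; have := lattice_part lt r0; rewrite !ci //.
  by case: (v =P r) => [<-|]; [rewrite ec //; lia|lia].
by move=> r ro; rewrite !cnt_cons !ci // ?ec //; lia.
Qed.

Lemma rsk_inj c1 c2 : matching c1 -> matching c2 -> rsk c1 = rsk c2 -> c1 = c2.
Proof.
elim: c1 c2 => [|x1 c1 IH] [|x2 c2] //=.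
- by case: x2 => //= p _; case: insert.
- by case: x1 => //= p _; case: insert.
case: x1 x2 => [p1|] [p2|] /=.
- move=> /andP[Hp1 m1] /andP[Hp2 m2].
  have := uninsertK Hp1; have := uninsertK Hp2.
  case: insert => t2 v2; case: insert => t1 v1 /= e2 e1 [] ev et.
  by move: e1; rewrite ev et e2 => -[/esym/IH-> // ->].
- move=> /andP[Hp1 m1] m2; by case: insert.
- move=> m1 /andP[Hp1 m2]; by case: insert.
- by move=> m1 m2 [/IH->].
Qed.

Lemma rsk_surj s : lattice s -> even_columns s ->
  exists2 c, matching c & rsk c = s.
Proof.
elim: {s}(size s) {-2}s (erefl (size s)) => [|n IH] [|x s] // => [_ _ _|/= [sn] [ps ls] es].
  by exists [::].
case: x ps es => [|r] ps es.
  have [||c mc ec] := IH s sn => //; last by exists (None :: c) => //=; rewrite ec.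
  by move=> r ro; have := es r ro; rewrite !cnt_cons /=; lia.
(* The latest label is even: before the arrival of an odd one, its row would have been shorter than
   the next row. *)
have or : odd r.
  case: (boolP (odd r)) => // er.
  have := es r.+1 er; rewrite !cnt_cons eqxx /= (_ : (r.+1 == r.+2) = false); last lia.
  by have := lattice_part ls (isT : 0 < r.+1); lia.
have r0 : 0 < r by case: (r) or.
have := es r or; rewrite !cnt_cons eqxx (_ : (r.+1 == r) = false) /=; last lia.
rewrite add0n => er.
have r1 : cnt s r.+1 < cnt s r by lia.
have [] := uninsertP ls r0 r1.
have := insert_size (uninsert r s).2 (uninsert r s).1.
case: uninsert => t p /= st Hp Hi lt.
rewrite Hi /= sn in st.
have [|c mc ec] := IH t (esym st) lt; last first.
  by exists (Some p :: c); rewrite /= ec ?Hp // Hi.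
move=> q qo; have := es q qo; rewrite !cnt_cons.
have q0 : 0 < q by case: (q) qo.
have := cnt_insert Hp q0; have := @cnt_insert _ _ q.+1 Hp isT; rewrite Hi /=.
case: (r.+1 =P q) => [e|_]; first by move: qo; rewrite -e /= or.
by rewrite eqSS; case: (r =P q.+1) => [e|_]; [move: or; rewrite e /= qo|lia].
Qed.

(** * Filling blanks from left to right, and the reverse process *)

Definition first_blank (s : seq nat) : nat := last 0 (blanks s).

Definition fill_first (s : seq nat) : seq nat := (insert (first_blank s) s).1.

Lemma first_blank_mem s : 0 < size (blanks s) -> first_blank s \in blanks s.
Proof. by rewrite /first_blank; case: blanks => //= x t _; apply: mem_last. Qed.

Lemma blanks_sorted s : sorted gtn (blanks s).
Proof.
elim: s => [|x s IH] //=; case: eqP => _ //=.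
rewrite path_min_sorted //; apply/allP => q /blanks_lt; by [].
Qed.

Lemma first_blank_le s q : q \in blanks s -> first_blank s <= q.
Proof.
rewrite /first_blank => Hq; have := blanks_sorted s.
case: (lastP (blanks s)) Hq => // t p; rewrite last_rcons mem_rcons inE.
rewrite -rev_sorted rev_rcons /= => /orP[/eqP->//|qt].
rewrite path_sortedE; last by move=> y x z /=; lia.
by move=> /andP[/allP/(_ q)]; rewrite mem_rev => /(_ qt) /ltnW.
Qed.

Lemma first_blank_eq s p : p \in blanks s ->
  (forall q, q \in blanks s -> p <= q) -> first_blank s = p.
Proof.
move=> Hp H; apply/eqP; rewrite eqn_leq first_blank_le //= H //.
by apply: first_blank_mem; case: blanks Hp.
Qed.

Lemma blanks_uniq s : uniq (blanks s).
Proof. by apply: sorted_uniq (blanks_sorted s) => [y x z|x] /=; lia. Qed.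

Lemma size_blanks_insert p s : p \in blanks s ->
  size (blanks s) = (size (blanks (insert p s).1)).+1.
Proof.
move=> Hp; rewrite (perm_size (perm_to_rem Hp)) /=; congr _.+1.
apply/perm_size/uniq_perm; rewrite ?rem_uniq ?blanks_uniq // => q.
by rewrite mem_rem_uniq ?blanks_uniq // inE mem_blanks_insert // andbC.
Qed.

(* Each odd row [r] exceeds row [r.+1] by its number of odd columns. *)
Definition odd_cols (s : seq nat) : nat :=
  \sum_(i < size s) (cnt s i.*2.+1 - cnt s i.*2.+2).

(** The last box of the strip lies in the highest odd row that is longer than the next row, so the
    removal of the strip starts there. *)
Definition first_odd_row (s : seq nat) : nat :=
  (find (fun i => cnt s i.*2.+2 < cnt s i.*2.+1) (iota 0 (size s))).*2.+1.

Definition empty_first (s : seq nat) : seq nat :=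
  (uninsert (first_odd_row s) s).1.

(** In a lattice word a label [r] requires all of [1, ..., r.-1] before it. *)
Lemma cnt_large s r : lattice s -> size s < r -> cnt s r = 0.
Proof.
elim: s r => [|x s IH] r //= [ps ls] sr; rewrite cnt_cons IH //; last lia.
case: eqP => // xr; have := ps r.-1; rewrite !cnt_cons prednK; last lia.
by rewrite (IH r.-1) //; [lia|lia].
Qed.

Lemma first_odd_rowP s v : lattice s -> odd v -> cnt s v.+1 < cnt s v ->
  (forall r, odd r -> cnt s r.+1 < cnt s r -> v <= r) -> first_odd_row s = v.
Proof.
move=> ls ov cv vmin; have vE : v = v./2.*2.+1 by lia.
rewrite /first_odd_row.
have vs : v <= size s by rewrite leqNgt; apply/negP => /(cnt_large ls); lia.
set a := (X in find X _).
have Ha : has a (iota 0 (size s)).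
  apply/hasP; exists v./2; rewrite ?mem_iota /a; first lia.
  by rewrite -vE.
have := nth_find 0 Ha; have := Ha; rewrite has_find size_iota => fs.
rewrite nth_iota // add0n => af.
have h1 : v <= (find a (iota 0 (size s))).*2.+1 by apply: vmin => //=; rewrite odd_double.
suff h2 : find a (iota 0 (size s)) <= v./2 by lia.
rewrite leqNgt; apply/negP => /(before_find 0); rewrite nth_iota; last lia.
by rewrite add0n /a -vE cv.
Qed.

Lemma odd_cols_eq0 s : lattice s -> (odd_cols s = 0 <-> even_columns s).
Proof.
move=> ls; split=> [/eqP|es].
  rewrite sum_nat_eq0 => /forallP H r ro.
  have := lattice_part ls (odd_gt0 ro).
  have [rs|rs] := ltnP r./2 (size s); last by rewrite !cnt_large //; lia.
  have := H (Ordinal rs); rewrite /=; have -> : r./2.*2 = r.-1 by lia.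
  by rewrite prednK ?odd_gt0 //; lia.
by apply: big1 => i _; rewrite (es i.*2.+1) ?subnn //= odd_double.
Qed.

(** A box in an odd row [v] affects only the difference between rows [v] and [v.+1], which it raises
    by one. *)
Lemma odd_cols_insert p s : p \in blanks s -> lattice s ->
  odd (insert p s).2 -> odd_cols (insert p s).1 = (odd_cols s).+1.
Proof.
move=> Hp ls; have := lattice_insert Hp ls; have := insert_size p s.
have := @cnt_insert p s ^~ Hp; case: insert => t v /= ct st lt ov.
have tv : 0 < cnt t v by rewrite ct ?(odd_gt0 ov) // eqxx addn1.
have vs : v <= size s.
  rewrite leqNgt -st; apply/negP => /(cnt_large lt); lia.
have v2 : v./2 < size s by lia.
rewrite /odd_cols st (bigD1 (Ordinal v2)) //= [in RHS](bigD1 (Ordinal v2)) //= -addSn.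
have vE : v./2.*2.+1 = v by lia.
congr addn.
  have := lattice_part ls (odd_gt0 ov); rewrite vE !ct // ?odd_gt0 //; lia.
apply: eq_bigr => i /eqP Hi; have {}Hi : nat_of_ord i <> v./2 by move=> e; apply: Hi; apply: val_inj.
rewrite !ct //; have -> : (v == i.*2.+1) = false by lia.
have e2 : (v == i.*2.+2) = false by lia.
by rewrite e2 !addn0.
Qed.

(* Inserting at the blanks from left to right adds boxes in weakly decreasing
   rows, hence a horizontal strip: at most one box below each (even) column. *)
Definition strip_ready (s : seq nat) : Prop :=
  forall r, odd r -> cnt s r.+1 < cnt s r -> first_blank s \in blanks s ->
  (insert (first_blank s) s).2 <= r.

(** After the box lands in row [v], this is the highest odd row longer than its successor. The next
    first blank lies further right, so by the bumping lemma its box is weakly above row [v]; and the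
    reverse process starts exactly at row [v]. *)
Lemma fill_firstK s : lattice s -> strip_ready s -> 0 < size (blanks s) ->
  let t := fill_first s in
  [/\ lattice t, strip_ready t, odd_cols t = (odd_cols s).+1,
      size (blanks s) = (size (blanks t)).+1 & empty_first t = s].
Proof.
move=> ls rs bs; have Hp := first_blank_mem bs.
have ov : odd (insert (first_blank s) s).2.
  by apply: insert_even_odd => // r ro cr; apply: rs.
rewrite /empty_first /fill_first /=.
have lt := lattice_insert Hp ls; have ct r := @cnt_insert _ s r Hp.
have bt q := @mem_blanks_insert _ s q Hp.
have K := uninsertK Hp.
rewrite odd_cols_insert // -size_blanks_insert //.
have T := @insert_twice_lt _ _ _ _ _ Hp (surjective_pairing _).
move: lt ct ov K T bt (fun r ro cr => rs r ro cr Hp).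
case: insert => t v /= lt ct ov K T bt vmin.
have dt r : odd r -> cnt t r.+1 < cnt t r -> v <= r.
  move=> ro; have r0 := odd_gt0 ro; have [->//|vr] := v =P r.
  rewrite !ct // => cr; apply: vmin => //; lia.
split=> //.
  move=> r ro cr Hq; apply: leq_trans (dt r ro cr).
  apply: T => //; move: Hq; rewrite bt => /andP[Hq nq].
  by rewrite ltn_neqAle eq_sym nq first_blank_le.
have cv : cnt t v.+1 < cnt t v.
  have v0 := odd_gt0 ov; rewrite !ct // eqxx; have := lattice_part ls v0; lia.
by rewrite (first_odd_rowP lt ov cv dt) K.
Qed.

(** Invariant of the reverse process: the position freed next lies to the left of all blanks, hence
    becomes the first blank. It holds vacuously for a word without blanks. *)
Definition unstrip_ready (s : seq nat) : Prop :=
  forall r q, odd r -> cnt s r.+1 < cnt s r -> q \in blanks s ->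
  (uninsert r s).2 < q.

Lemma empty_firstK s : lattice s -> unstrip_ready s -> 0 < odd_cols s ->
  let t := empty_first s in
  [/\ lattice t, unstrip_ready t, odd_cols s = (odd_cols t).+1,
      size (blanks t) = (size (blanks s)).+1 & fill_first t = s].
Proof.
move=> ls us os.
have : exists i, [&& i < size s & cnt s i.*2.+2 < cnt s i.*2.+1].
  move: os; rewrite lt0n sum_nat_eq0 => /forallPn[[i Hi] /=].
  by rewrite subn_eq0 -ltnNge => H; exists i; rewrite Hi.
move=> /ex_minnP[i /andP[_ ci] imin].
have ov : odd i.*2.+1 by rewrite /= odd_double.
have dmin r : odd r -> cnt s r.+1 < cnt s r -> i.*2.+1 <= r.
  move=> ro cr; have rE : r = r./2.*2.+1 by lia.
  suff : i <= r./2 by lia.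
  apply: imin; rewrite -rE cr andbT.
  suff : r <= size s by lia.
  by rewrite leqNgt; apply/negP => /(cnt_large ls); lia.
rewrite /empty_first (first_odd_rowP ls ov ci dmin).
move: (i.*2.+1) ov ci dmin => v ov cv dmin {i imin}.
have [] := uninsertP ls (odd_gt0 ov) cv.
have := fun q => @us v q ov cv.
case: uninsert => t p /= pmin Hp Hi lt.
have bs q := @mem_blanks_insert _ t q Hp; have cs r := @cnt_insert _ t r Hp.
have szb := size_blanks_insert Hp.
have os2 := odd_cols_insert Hp lt.
have T := @insert_twice_gt p.
rewrite Hi /= in bs cs szb os2.
have fp : first_blank t = p.
  apply: first_blank_eq => // q Hq; have [->//|/eqP qp] := q =P p.
  by apply/ltnW/pmin; rewrite bs Hq.
split=> //; last by rewrite /fill_first fp Hi.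
  move=> r q ro cr Hq.
  have rv : v <= r.
    by have r0 := odd_gt0 ro; apply: dmin => //; rewrite !cs //; lia.
  have [] := uninsertP lt (odd_gt0 ro) cr.
  case: uninsert => t2 p2 /= Hp2 Hi2 lt2.
  have bt2 x := @mem_blanks_insert _ t2 x Hp2; rewrite Hi2 /= in bt2.
  (* If [p2] were to the right of [p], then inserting [p] after [p2] would land strictly below row
     [r], whereas it lands in row [v <= r]. *)
  have p2p : p2 < p.
    rewrite ltnNge leq_eqVlt; apply/negP => /orP[/eqP e|pp2].
      by move: Hp; rewrite bt2 e eqxx andbF.
    by have := @insert_twice_gt p2 p t2 t r Hp2 Hi2 Hp pp2; rewrite Hi /=; lia.
  have [->//|/eqP qp] := q =P p; apply: ltn_trans p2p _.
  by apply: pmin; rewrite bs Hq.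
by rewrite os2.
Qed.

Lemma iter_fill_firstK m s : lattice s -> strip_ready s -> m <= size (blanks s) ->
  let t := iter m fill_first s in
  [/\ lattice t, strip_ready t, odd_cols t = odd_cols s + m,
      size (blanks s) = size (blanks t) + m & iter m empty_first t = s].
Proof.
move=> ls rs; elim: m => [|m IH] ms /=; first by rewrite !addn0.
have /= [lt rt ot bt K] := IH (ltnW ms).
have bt0 : 0 < size (blanks (iter m fill_first s)) by lia.
have /= [l1 r1 o1 b1 K1] := fill_firstK lt rt bt0.
by split=> //; [rewrite o1 ot addnS | rewrite bt b1 addSnnS | rewrite -iterS iterSr K1].
Qed.

Lemma iter_empty_firstK m s : lattice s -> unstrip_ready s -> m <= odd_cols s ->
  let t := iter m empty_first s in
  [/\ lattice t, unstrip_ready t, odd_cols s = odd_cols t + m,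
      size (blanks t) = size (blanks s) + m & iter m fill_first t = s].
Proof.
move=> ls rs; elim: m => [|m IH] ms /=; first by rewrite !addn0.
have /= [lt rt ot bt K] := IH (ltnW ms).
have ot0 : 0 < odd_cols (iter m empty_first s) by lia.
have /= [l1 r1 o1 b1 K1] := empty_firstK lt rt ot0.
by split=> //; [rewrite ot o1 addSnnS | rewrite b1 bt addnS | rewrite -iterS iterSr K1].
Qed.

(** * Lattice words and standard tableaux *)

(** Positions count from 0 and tableau entries from 1, whence the successor. *)
Fixpoint row_of (r : nat) (y : seq nat) : seq nat :=
  if y is x :: y' then
    if x == r then rcons (row_of r y') (size y').+1 else row_of r y'
  else [::].

Definition num_rows (y : seq nat) : nat := foldr maxn 0 y.

Definition tableau (y : seq nat) : seq (seq nat) :=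
  mkseq (fun i => row_of i.+1 y) (num_rows y).

Definition label (T : seq (seq nat)) (t : nat) : nat :=
  (find (fun r => t \in r) T).+1.

Fixpoint word (T : seq (seq nat)) (t : nat) : seq nat :=
  if t is t'.+1 then label T t :: word T t' else [::].

Lemma size_row_of r y : size (row_of r y) = cnt y r.
Proof.
elim: y => [|x y IH] //=; rewrite cnt_cons; case: eqP => _ /=.
  by rewrite size_rcons IH.
by rewrite IH.
Qed.

Lemma mem_row_of r y t :
  (t \in row_of r y) = (0 < t <= size y) && (nth 0 y (size y - t) == r).
Proof.
elim: y t => [|x y IH] t /=; first by rewrite in_nil; lia.
have [->|nt] := eqVneq t (size y).+1.
  rewrite subnn ltnSn /=; case: eqP => _.
    by rewrite mem_rcons inE eqxx.
  by rewrite IH ltnn andbF.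
have -> : (t \in if x == r then rcons (row_of r y) (size y).+1 else row_of r y)
   = (t \in row_of r y).
  by case: eqP => _ //; rewrite mem_rcons inE (negPf nt).
rewrite IH; have [ty|ty] := leqP t (size y).
  by rewrite subSn //= (leq_trans ty).
have -> : (t <= (size y).+1) = false by lia.
by rewrite !andbF.
Qed.

Lemma row_of_sorted r y : sorted ltn (row_of r y).
Proof.
elim: y => [|x y IH] //=; case: eqP => _ //.
move: IH (mem_row_of r y); case: (row_of r y) => [|a l] //= pl ml.
rewrite rcons_path pl /=; have := mem_last a l; by rewrite ml => /andP[/andP[]].
Qed.

Lemma cnt_le_num_rows y r : num_rows y < r -> cnt y r = 0.
Proof.
elim: y => [|x y IH] //=; rewrite gtn_max => /andP[xr /IH yr].
by rewrite cnt_cons yr; case: eqP xr => // ->; rewrite ltnn.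
Qed.

Lemma lattice_leq s i j : lattice s -> 0 < i -> i <= j -> cnt s j <= cnt s i.
Proof.
move=> /lattice_part ps i0; elim: j => [|j IH]; first by case: i i0.
rewrite leq_eqVlt => /orP[/eqP->//|ij].
apply: leq_trans (IH ij); apply: ps; exact: leq_trans i0 ij.
Qed.

(** The largest label occurs, and the lattice property then forces every smaller positive label to
    occur. *)
Lemma cnt_gt0_num_rows y r : lattice y -> 0 < r ->
  (0 < cnt y r) = (r <= num_rows y).
Proof.
move=> ly r0; have [ry|yr] := leqP r (num_rows y); last by rewrite cnt_le_num_rows.
apply: leq_trans (lattice_leq ly r0 ry).
have : 0 < num_rows y by apply: leq_trans ry.
rewrite /cnt -has_count has_pred1; elim: (y) => [|x s IH] //.
rewrite [num_rows _]/= -/(num_rows s); have [xs|xs] := ltnP x (num_rows s); rewrite inE ?eqxx // => s0.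
by rewrite IH ?orbT.
Qed.

Lemma num_rows_leq y h : (num_rows y <= h) = all (leq^~ h) y.
Proof. by elim: y => [|x y IH] //=; rewrite geq_max IH. Qed.

Lemma nth_tableau y i : nth [::] (tableau y) i = row_of i.+1 y.
Proof.
have [iy|iy] := ltnP i (num_rows y); first by rewrite nth_mkseq.
rewrite nth_default ?size_mkseq //; apply/esym/nilP.
by rewrite /nilp size_row_of cnt_le_num_rows.
Qed.

Lemma sum_cnt y R : \sum_(i < R) cnt y i.+1 = count (fun x => 0 < x <= R) y.
Proof.
elim: y => [|x y IH] /=; first by rewrite big1.
rewrite -IH -[in RHS](big_mkord xpredT (fun i => cnt y i.+1)).
rewrite -(big_mkord xpredT (fun i => cnt (x :: y) i.+1)).
rewrite (eq_bigr (fun i => (x == i.+1) + cnt y i.+1)) // big_split /=; congr addn.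
rewrite big_mkord; case: x => [|x] /=; first by rewrite big1.
have [xR|xR] := ltnP x R; last by rewrite big1 // => i _; have := ltn_ord i; case: eqP; lia.
rewrite (bigD1 (Ordinal xR)) //= eqxx big1 ?addn0 // => i /eqP Hi.
by case: eqP => // -[e]; case: Hi; apply: val_inj.
Qed.

(** Row lengths weakly decrease, so the rows that reach column [j] come first, and entry [i] of the
    column belongs to row [i]. *)
Lemma filter_column (T : seq (seq nat)) j : sorted geq (shape T) ->
  [seq r <- T | j < size r] = take (count (fun r => j < size r) T) T.
Proof.
elim: T => [|r T IH] //= pT.
have sT : sorted geq (shape T) by apply: path_sorted pT.
case: ltnP => jr; first by rewrite /= IH.
have : all (geq (size r)) (shape T).
  by apply: order_path_min pT => x y z /= ; lia.
rewrite add0n all_map => /allP aT.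
have a0 : {in T, (fun r => j < size r) =1 pred0}.
  by move=> x /aT /=; lia.
by rewrite (eq_in_count a0) (eq_in_filter a0) count_pred0 filter_pred0 take0.
Qed.

Lemma columns_sortedP (T : seq (seq nat)) : sorted geq (shape T) ->
  reflect (forall i j, j < size (nth [::] T i.+1) ->
             nth 0 (nth [::] T i) j < nth 0 (nth [::] T i.+1) j)
          (all (sorted ltn) (columns T)).
Proof.
move=> sT.
have ss i : size (nth [::] T i.+1) <= size (nth [::] T i).
  have [iT|iT] := ltnP i.+1 (size T); last by rewrite (nth_default _ iT).
  have := (sortedP 0 sT) i; rewrite size_map => /(_ iT).
  by rewrite !(nth_map [::]) // ltnW.
have s0 i : size (nth [::] T i) <= size (head [::] T).
  by elim: i => [|i IH]; [rewrite nth0|exact: leq_trans (ss i) IH].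
have ci i j : (j < size (nth [::] T i)) = (i < count (fun r => j < size r) T).
  elim: (T) i sT => [|r U IH] i /= pU; first by rewrite nth_nil.
  have sU : sorted geq (shape U) by apply: path_sorted pU.
  case: i => [|i] /=; last first.
    rewrite IH //; case: (ltnP j) => // jr.
    have : all (geq (size r)) (shape U).
      by apply: order_path_min pU => x y z /= ; lia.
    rewrite add0n all_map => /allP aU.
    have a0 : {in U, (fun r => j < size r) =1 pred0} by move=> x /aU /=; lia.
    by rewrite (eq_in_count a0) count_pred0.
  case: ltnP => // jr; rewrite add0n.
  have : all (geq (size r)) (shape U).
    by apply: order_path_min pU => x y z /= ; lia.
  rewrite all_map => /allP aU.
  have a0 : {in U, (fun r => j < size r) =1 pred0} by move=> x /aU /=; lia.
  by rewrite (eq_in_count a0) count_pred0.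
have cs j : size (column T j) = count (fun r => j < size r) T.
  by rewrite size_map size_filter.
have cn i j : i < count (fun r => j < size r) T ->
  nth 0 (column T j) i = nth 0 (nth [::] T i) j.
  move=> ic; rewrite /column (nth_map [::]) ?size_filter //.
  by rewrite filter_column // nth_take.
apply: (iffP allP) => [H i j|H c /mapP[j _ ->]].
  move=> /[dup] jT; rewrite ci => jc; rewrite -!cn //; last exact: ltnW.
  have /H/sortedP : column T j \in columns T.
    apply/mapP; exists j => //; rewrite mem_iota add0n /=.
    exact: leq_trans jT (s0 _).
  by move=> /(_ 0 i); apply; rewrite cs.
apply/(sortedP 0) => i; rewrite cs => ic; rewrite !cn //; last exact: ltnW.
by apply: H; rewrite ci.
Qed.

(** When box [j] of row [r.+1] arrives, the lattice condition at that moment says that row [r]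
    already has its box [j]. *)
Lemma row_of_lt y r j : lattice y -> 0 < r -> j < cnt y r.+1 ->
  nth 0 (row_of r y) j < nth 0 (row_of r.+1 y) j.
Proof.
move=> + r0; elim: y => [|x y IH] //= [py ly]; rewrite cnt_cons => jc.
have := py r r0; rewrite !cnt_cons.
have pr := lattice_part ly r0.
case: (x =P r.+1) jc => [->|xr] jc.
  rewrite (_ : (r.+1 == r) = false) /=; last lia.
  rewrite nth_rcons size_row_of; have [jy|jy] := ltnP j (cnt y r.+1) => c1; first exact: IH.
  have ej : j = cnt y r.+1 by lia.
  rewrite ej eqxx ltnS; have : nth 0 (row_of r y) (cnt y r.+1) \in row_of r y.
    by apply: mem_nth; rewrite size_row_of; lia.
  by rewrite mem_row_of; lia.
case: eqP => _ _; last exact: IH.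
by rewrite nth_rcons size_row_of ifT; [apply: IH|lia].
Qed.

(** The left sum is the length of column [j] in a diagram with row lengths [f]. The column is odd
    iff its last box is in a row [i.*2], counted from 0, and this happens for at most one [i]. *)
Lemma odd_count_alternating (f : nat -> nat) j K :
  (forall i, f i.+1 <= f i) ->
  odd (\sum_(i < K.*2) (j < f i)) = \sum_(i < K) (f i.*2.+1 <= j < f i.*2) :> nat.
Proof.
elim: K f => [|K IH] f fd; first by rewrite !big_ord0.
rewrite doubleS !big_ord_recl /=.
have := IH (fun i => f i.+2) (fun i => fd i.+2) => {}IH.
have -> : \sum_(i < K) (f (bump 0 i).*2.+1 <= j < f (bump 0 i).*2)
  = \sum_(i < K) (f i.*2.+3 <= j < f i.*2.+2) by apply: eq_bigr => i _; rewrite /bump /= doubleS.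
rewrite -IH /bump /= double0.
have -> : \sum_(i < K.*2) (j < f (1 + (1 + i))) = \sum_(i < K.*2) (j < f i.+2) by apply: eq_bigr.
have [j1|j1] := ltnP j (f 1).
  have j0 : j < f 0 by apply: leq_trans (fd 0).
  by rewrite j0 ?oddD /= ?negbK.
rewrite big1 ?addn0 /=; first by case: (j < f 0).
move=> i _; suff -> : (j < f i.+2) = false by [].
apply/negbTE; rewrite -leqNgt; apply: leq_trans j1.
by elim: (nat_of_ord i) => [|k Ik]; [apply: fd|apply: leq_trans Ik; apply: fd].
Qed.

Lemma sum_between B a b : a <= B -> b <= a -> \sum_(j < B) (b <= j < a) = a - b.
Proof.
move=> aB ba; elim: B a aB ba => [|B IH] a; first by rewrite leqn0 => /eqP->; rewrite big_ord0.
rewrite leq_eqVlt => /orP[/eqP->|aB] ba; rewrite big_ord_recr /=; last first.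
  by rewrite IH // ; lia.
move: ba; rewrite leq_eqVlt => /orP[/eqP->|bB].
  by rewrite ltnn subnn big1 // => i _; case: leqP => //; have := ltn_ord i; lia.
have {}bB : b <= B := bB; rewrite bB ltnSn /= subSn // addn1 -(IH B) //; congr _.+1.
by apply: eq_bigr => i _; rewrite ltn_ord ltnS (ltnW (ltn_ord i)).
Qed.

Lemma iota0E n : iota 0 n = index_iota 0 n.
Proof. by rewrite /index_iota subn0. Qed.

(** Double counting of the odd columns together with the row where each ends: grouped by that row,
    they give the differences summed in [odd_cols]. *)
Lemma odd_columns_tableau y : lattice y ->
  odd_columns (tableau y) = odd_cols y.
Proof.
move=> ly.
have hd : size (head [::] (tableau y)) = cnt y 1.
  by rewrite -nth0 nth_tableau size_row_of.
rewrite /odd_columns /columns hd count_map -sum1_count big_mkcond /=.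
rewrite iota0E big_mkord.
pose f i := cnt y i.+1.
have fd i : f i.+1 <= f i by apply: (lattice_part ly).
have ns : num_rows y <= (size y).*2.
  rewrite leqNgt; apply/negP => h.
  have := cnt_gt0_num_rows ly (leq_ltn_trans (leq0n _) h).
  by rewrite leqnn cnt_large //; lia.
have cs j : size (column (tableau y) j) = \sum_(i < (size y).*2) (j < f i).
  rewrite size_map size_filter count_map -sum1_count big_mkcond /=.
  rewrite iota0E.
  rewrite -(big_mkord xpredT (fun i => (j < f i) : nat)) [RHS](big_cat_nat (n := num_rows y)) //=.
  rewrite [X in _ = _ + X]big1_seq ?addn0.
    by apply: eq_bigr => i _; rewrite size_row_of; case: ltnP.
  move=> i /andP[_]; rewrite mem_index_iota => /andP[ni _].
  by rewrite /f cnt_le_num_rows.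
rewrite (eq_bigr (fun j : 'I__ => \sum_(i < size y) (f i.*2.+1 <= j < f i.*2))); last first.
  by move=> j _; rewrite cs -odd_count_alternating //; case: odd.
rewrite exchange_big /=; apply: eq_bigr => i _.
by rewrite sum_between // /f; apply: lattice_leq.
Qed.

Lemma tableau_standard y : lattice y -> 0 \notin y ->
  is_standard_tableau (size y) (tableau y).
Proof.
move=> ly y0; have shE : shape (tableau y) = mkseq (fun i => cnt y i.+1) (num_rows y).
  by rewrite /shape -map_comp; apply: eq_map => i /=; rewrite size_row_of.
have sT : sorted geq (shape (tableau y)).
  rewrite shE; apply/(sortedP 0) => i; rewrite size_mkseq => iy.
  by rewrite !nth_mkseq // 1?ltnW //; apply: (lattice_part ly).
apply/and4P; split.
- rewrite /is_partition sT shE /=; apply/allP => c /mapP[i]; rewrite mem_iota add0n => /= iy ->.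
  by rewrite cnt_gt0_num_rows.
(* The rows contain each of [1, ..., size y] and have [size y] entries in total, so nothing is
   repeated. *)
- rewrite perm_sym.
  have sub (t : nat) : t \in iota 1 (size y) -> t \in flatten (tableau y).
    rewrite mem_iota add1n ltnS => ty.
    pose r := nth 0 y (size y - t).
    have ry : r \in y by apply: mem_nth; case/andP: (ty) => t0 ts; rewrite ltn_subrL t0 (leq_trans t0 ts).
    have r0 : 0 < r by rewrite lt0n; apply: contraNneq y0 => <-.
    have rn : r <= num_rows y.
      have : all (leq^~ (num_rows y)) y by rewrite -num_rows_leq.
      by move/allP => /(_ r ry).
    apply/flattenP; exists (row_of r y); last by rewrite mem_row_of ty eqxx.
    by apply/mapP; exists r.-1; rewrite ?mem_iota ?prednK //; lia.
  have sz : size (flatten (tableau y)) = size y.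
    rewrite size_flatten shE sumnE big_map iota0E big_mkord.
    rewrite sum_cnt; apply/eqP; rewrite -all_count.
    apply/allP => x xy; have : all (leq^~ (num_rows y)) y by rewrite -num_rows_leq.
    move/allP => /(_ x xy) ->; rewrite andbT lt0n; by apply: contraNneq y0 => <-.
  have szl : size (flatten (tableau y)) <= size (iota 1 (size y)) by rewrite sz size_iota.
  have u := iota_uniq 1 (size y).
  apply: uniq_perm => //; first exact: leq_size_uniq u sub szl.
  by have [] := uniq_min_size u sub szl.
- by apply/allP => r /mapP[i _ ->]; apply: row_of_sorted.
- apply/columns_sortedP => // i j; rewrite !nth_tableau size_row_of => jc.
  exact: row_of_lt.
Qed.

Lemma nth_word T n i : i < n -> nth 0 (word T n) i = label T (n - i).
Proof.
elim: n i => [|n IH] [|i] //= iN; first by rewrite IH.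
Qed.

Lemma size_word T n : size (word T n) = n.
Proof. by elim: n => //= n ->. Qed.

Lemma tableauK y : lattice y -> 0 \notin y -> word (tableau y) (size y) = y.
Proof.
move=> ly y0; apply: (@eq_from_nth _ 0); rewrite size_word // => i iy.
rewrite nth_word //; set r := nth 0 y i.
have ry : r \in y by apply: mem_nth.
have r0 : 0 < r by rewrite lt0n; apply: contraNneq y0 => <-.
have rn : r <= num_rows y.
  have : all (leq^~ (num_rows y)) y by rewrite -num_rows_leq.
  by move/allP => /(_ r ry).
rewrite /label; set a := fun _ => _.
have mE q : (size y - i \in row_of q y) = (r == q).
  by rewrite mem_row_of subKn ?(ltnW iy) // -/r; have -> : 0 < size y - i <= size y by lia.
have Ha : has a (tableau y).
  apply/hasP; exists (row_of r y); last by rewrite /a mE.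
  by apply/mapP; exists r.-1; rewrite ?mem_iota ?prednK //; lia.
by have := nth_find [::] Ha; rewrite nth_tableau {1}/a mE => /eqP ->.
Qed.

Lemma count_leq_nth r1 r2 t : size r2 <= size r1 ->
  (forall j, j < size r2 -> nth 0 r1 j <= nth 0 r2 j) ->
  (forall j, j < size r1 -> 0 < nth 0 r1 j) ->
  count (fun x => 0 < x <= t) r2 <= count (fun x => 0 < x <= t) r1.
Proof.
elim: r1 r2 => [|a r1 IH] [|b r2] //= sz H P.
have := H 0 isT; have := P 0 isT => /= a0 ab.
have : count (fun x => 0 < x <= t) r2 <= count (fun x => 0 < x <= t) r1.
  by apply: IH => // j jr; [apply: (H j.+1)|apply: (P j.+1)].
lia.
Qed.

Lemma mem_nth_flatten (S : eqType) (T : seq (seq S)) i t :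
  t \in nth [::] T i -> t \in flatten T.
Proof.
elim: T i => [|r T IH] [|i] //=.
  by rewrite mem_cat => ->.
by move=> /IH H; rewrite mem_cat H orbT.
Qed.

Lemma uniq_flatten_nth (S : eqType) (T : seq (seq S)) i j t :
  uniq (flatten T) -> t \in nth [::] T i -> t \in nth [::] T j -> i = j.
Proof.
elim: T i j => [|r T IH] [|i] [|j] //=; rewrite cat_uniq => /and3P[_ /hasPn rT uT].
- by move=> tr /mem_nth_flatten/rT /=; rewrite tr.
- by move=> /mem_nth_flatten/rT /= /[swap] ->.
- by move=> ti tj; congr _.+1; apply: IH uT ti tj.
Qed.

(** At each time [t] the count of a label is the number of entries at most [t] in the corresponding
    row of [T]; increasing columns make these numbers weakly decrease down the rows. *)
Lemma word_lattice n T : is_standard_tableau n T ->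
  [/\ lattice (word T n), 0 \notin word T n & tableau (word T n) = T].
Proof.
case/and4P => /andP[sT pT] fT rT cT.
have uT : uniq (flatten T) by rewrite (perm_uniq fT) iota_uniq.
have mT t : (t \in flatten T) = (0 < t <= n).
  by rewrite (perm_mem fT) mem_iota add1n ltnS.
have ur i j t : t \in nth [::] T i -> t \in nth [::] T j -> i = j.
  exact: uniq_flatten_nth.
have lT t i : 0 < t <= n -> (label T t == i.+1) = (t \in nth [::] T i).
  rewrite -mT => /flattenP[r rT' tr]; rewrite /label eqSS.
  have Ha : has (fun r => t \in r) T by apply/hasP; exists r.
  have tf := nth_find [::] Ha.
  by apply/eqP/idP => [<-//|ti]; apply: ur tf ti.
have pos i j : j < size (nth [::] T i) -> 0 < nth 0 (nth [::] T i) j <= n.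
  move=> ji; rewrite -mT; apply/flattenP; exists (nth [::] T i); last exact: mem_nth.
  apply: mem_nth; case: ltnP => // Ti; by rewrite nth_default in ji.
have ru i : uniq (nth [::] T i).
  have [iT|iT] := ltnP i (size T); last by rewrite nth_default.
  apply: (@sorted_uniq _ ltn) => //; first exact: ltn_trans.
    by move=> x /=; rewrite ltnn.
  by apply: (allP rT); apply: mem_nth.
have cE t i : t <= n -> cnt (word T t) i.+1 = count (fun x => 0 < x <= t) (nth [::] T i).
  elim: t => [|t IH] tn /=.
    by apply/esym/eqP; rewrite -leqn0 leqNgt -has_count; apply/hasPn => x _; lia.
  rewrite cnt_cons IH; last exact: ltnW.
  rewrite lT // -count_uniq_mem // -count_predUI.
  rewrite addnC [X in X + _](_ : _ = 0) ?add0n.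
    by apply: eq_count => x /=; lia.
  by apply/eqP; rewrite -leqn0 leqNgt -has_count; apply/hasPn => x _ /=; lia.
have ss i : size (nth [::] T i.+1) <= size (nth [::] T i).
  have [iT|iT] := ltnP i.+1 (size T); last by rewrite (nth_default _ iT).
  have := (sortedP 0 sT) i; rewrite size_map => /(_ iT).
  by rewrite !(nth_map [::]) // ltnW.
have lw t : t <= n -> lattice (word T t).
  elim: t => [|t IH] //= tn; split; last exact/IH/ltnW.
  case=> // r _; rewrite -[_ :: _]/(word T t.+1) !cE //.
  apply: count_leq_nth => // j jr; last by case/andP: (pos _ _ jr).
  by apply/ltnW/(columns_sortedP sT).
have l := lw n (leqnn n).
have w0 : 0 \notin word T n.
  by elim: (n) => //= t IH; rewrite inE negb_or IH.
split=> //.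
have rE i : row_of i.+1 (word T n) = nth [::] T i.
  apply: (irr_sorted_eq ltn_trans ltnn); first exact: row_of_sorted.
    have [iT|iT] := ltnP i (size T); last by rewrite nth_default.
    by apply: (allP rT); apply: mem_nth.
  move=> t; rewrite mem_row_of size_word.
  case: (boolP (0 < t <= n)) => /= tn.
    by rewrite nth_word ?subKn ?lT //; lia.
  apply/esym/negbTE; apply: contra tn => ti; rewrite -mT; apply/flattenP.
  exists (nth [::] T i) => //.
  by apply: mem_nth; case: ltnP => // Ti; rewrite nth_default in ti.
have nE : num_rows (word T n) = size T.
  have cs r : (r < size T) = (r < num_rows (word T n)).
    rewrite -cnt_gt0_num_rows // -size_row_of rE.
    have [rT'|rT'] := ltnP r (size T); last by rewrite nth_default.
    have -> // : 0 < size (nth [::] T r).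
    by apply: (allP pT); apply: map_f; apply: mem_nth.
  apply/eqP; rewrite eqn_leq; apply/andP; split.
    by case: num_rows cs => // k cs; rewrite cs.
  by case: size cs => // k cs; rewrite -cs.
apply: (@eq_from_nth _ [::]); first by rewrite size_mkseq.
by move=> i _; rewrite nth_tableau.
Qed.

(** * Matchings and oscillating tableaux *)

(** For a partition these are the parts of its conjugate. Steps are tracked by columns because
    labels are column indices. *)
Definition col_len (la : seq nat) (r : nat) : nat := count (leq r) la.

Arguments col_len : simpl never.

Lemma leq_nth_col_len la r i : sorted geq la -> 0 < r ->
  (r <= nth 0 la i) = (i < col_len la r).
Proof.
move=> + r0; rewrite /col_len; elim: la i => [|a la IH] i /= sl; first by rewrite nth_nil leqNgt r0.
have sla : sorted geq la by apply: path_sorted sl.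
case: (leqP r a) => ra; first by case: i => [|i] //=; rewrite IH // add1n ltnS.
have al : all (geq a) la by apply: order_path_min sl => x y z /=; lia.
have -> : count (leq r) la = 0.
  apply/eqP; rewrite -leqn0 leqNgt -has_count; apply/hasPn => x xl.
  by have := allP al _ xl; move=> /=; lia.
case: i => [|i] /=; first by apply/negbTE; rewrite -ltnNge.
apply/negbTE; rewrite -ltnNge.
have [il|il] := ltnP i (size la); last by rewrite nth_default.
by have := allP al _ (mem_nth 0 il) => /=; lia.
Qed.

Lemma col_len1 la : is_partition la -> col_len la 1 = size la.
Proof. by case/andP => _; rewrite all_count => /eqP. Qed.

Lemma col_len_inj la mu : is_partition la -> is_partition mu ->
  (forall r, 0 < r -> col_len la r = col_len mu r) -> la = mu.
Proof.
move=> pl pm H; case/andP: (pl) => sl _; case/andP: (pm) => sm _.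
apply: (@eq_from_nth _ 0); first by rewrite -!col_len1 // H.
move=> i _; apply/eqP; rewrite eqn_leq.
have E r : 0 < r -> (r <= nth 0 la i) = (r <= nth 0 mu i).
  by move=> r0; rewrite !leq_nth_col_len // H.
apply/andP; split.
  by case: (posnP (nth 0 la i)) => [->//|n0]; rewrite -E.
by case: (posnP (nth 0 mu i)) => [->//|n0]; rewrite E.
Qed.

Lemma col_len_incr la i r : i <= size la -> 0 < r ->
  col_len (incr_nth la i) r = ((nth 0 la i).+1 == r) + col_len la r.
Proof.
move=> + r0; rewrite /col_len; elim: la i => [|a la IH] [|i] //=.
- by move=> _; lia.
- by rewrite /= => _; lia.
by rewrite ltnS => /IH ->; lia.
Qed.

Lemma col_len_part la : part (col_len la).
Proof. by move=> r _; apply: sub_count => x /= /ltnW. Qed.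

Lemma add_box_col_len la mu : add_box la mu ->
  exists2 r, 0 < r & forall q, 0 < q -> col_len mu q = (r == q) + col_len la q.
Proof.
case/existsP=> i /eqP ->; exists (nth 0 la i).+1 => // q q0.
by rewrite col_len_incr // -ltnS.
Qed.

(** A box added to column [x] goes into row [col_len la x], counted from 0. The hypothesis says that
    column [x.-1] is longer than column [x], so this row has length exactly [x.-1]. *)
Lemma incr_col_len la x : is_partition la -> 0 < x ->
  part (fun r => (x == r) + col_len la r) ->
  let mu := incr_nth la (col_len la x) in
  is_partition mu /\ forall r, 0 < r -> col_len mu r = (x == r) + col_len la r.
Proof.
move=> /andP[sl pl] x0 px; have isz : col_len la x <= size la by apply: count_size.
set i := col_len la x in isz *.
have nx : nth 0 la i = x.-1.
  apply/eqP; rewrite eqn_leq; apply/andP; split.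
    by rewrite -ltnS prednK // ltnNge leq_nth_col_len // ltnn.
  case: (posnP x.-1) => [->//|x1]; rewrite leq_nth_col_len //.
  by have := px _ x1; rewrite prednK // eqxx (_ : (x == x.-1) = false); lia.
split; last by move=> r r0; rewrite col_len_incr // nx prednK.
apply/andP; split.
  apply/(sortedP 0) => j _; rewrite /= !nth_incr_nth.
  have lj : nth 0 la j.+1 <= nth 0 la j.
    have [jl|jl] := ltnP j.+1 (size la); first by apply: (sortedP 0 sl).
    by rewrite (nth_default _ jl).
  case: (i =P j.+1) => [ij|_]; last by case: eqP => _; lia.
  have : x <= nth 0 la j by rewrite leq_nth_col_len // -/i ij.
  by rewrite -ij nx; lia.
apply/(all_nthP 0) => j; rewrite size_incr_nth nth_incr_nth => js.
case: (i =P j) => // ij; apply: (all_nthP 0 pl).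
by move: js; case: ifP; lia.
Qed.

Lemma col_len_add_box la mu x : is_partition la -> is_partition mu -> 0 < x ->
  (forall q, 0 < q -> col_len mu q = (x == q) + col_len la q) -> add_box la mu.
Proof.
move=> pl pm x0 H.
have px : part (fun r => (x == r) + col_len la r).
  by move=> r r0; rewrite -!H //; apply: col_len_part.
have [p1 c1] := incr_col_len pl x0 px.
have i0 : col_len la x < (size la).+1 by rewrite ltnS; apply: count_size.
apply/existsP; exists (Ordinal i0) => /=; apply/eqP.
by apply: col_len_inj => // r r0; rewrite H // c1.
Qed.

(* A label is the index of the column receiving a box, so that column [r] has
   length [cnt u r]. *)
Fixpoint diagram (u : seq nat) : seq nat :=
  if u is x :: u' then
    if x == 0 then diagram u' else incr_nth (diagram u') (cnt u' x)
  else [::].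

Lemma diagramP u : lattice u ->
  is_partition (diagram u) /\ forall r, 0 < r -> col_len (diagram u) r = cnt u r.
Proof.
elim: u => [|x u IH] //= [pu lu]; have [pd cd] := IH lu.
case: eqP => [->|/eqP]; first by split=> // r r0; rewrite cd // cnt_cons; lia.
rewrite -lt0n => x0; rewrite -cd //.
have [|p1 c1] := incr_col_len pd x0.
  by move=> r r0; rewrite !cd //; exact: pu.
by split=> // r r0; rewrite c1 // cd.
Qed.

(** Runs back in time from the final state [u]: undoing a closer inserts its point [p] again,
    undoing an opener forgets its label. The last shape therefore comes first. *)
Fixpoint osc_of (c : seq (option nat)) (u : seq nat) : seq (seq nat) :=
  if c isn't x :: c' then [:: [::]] else
  diagram u ::
    osc_of c' (if x is Some p then (insert p (behead u)).1 else behead u).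

(* In the state [u] the open points carry the labels and the others are blank;
   in [rsk c] it is the converse. *)
Definition compatible (c : seq (option nat)) (u : seq nat) : Prop :=
  [/\ size u = size c, lattice u
    & forall q, q < size c -> (q \in blanks u) = (q \notin blanks (rsk c))].

Lemma compatible_none c x u :
  compatible (None :: c) (x :: u) <->
  [/\ 0 < x, compatible c u & part (cnt (x :: u))].
Proof.
split=> [[/= [su] [px lu] H]|[x0 [su lu H] px]].
  have x0 : 0 < x.
    rewrite lt0n; apply/negP => /eqP x0; have := H (size c) (ltnSn _).
    by rewrite x0 /= !inE su rsk_size eqxx.
  split=> //; split=> // q qc; have := H q (ltnW qc).
  rewrite !inE rsk_size; have -> : (q == size c) = false by lia.
  by rewrite gtn_eqF.
split=> /=; [by rewrite su|by []|].
move=> q; rewrite (gtn_eqF x0) inE rsk_size ltnS leq_eqVlt => /orP[/eqP->|qc].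
  by rewrite eqxx /= -su blanks_size_notin.
by rewrite H //; have -> : (q == size c) = false by lia.
Qed.

Lemma mem_blanks_rsk_some p c q : p \in blanks (rsk c) ->
  (q \in blanks (rsk (Some p :: c))) = (q \in blanks (rsk c)) && (q != p).
Proof. by move=> Hp; rewrite -mem_blanks_insert //= ; case: insert. Qed.

Lemma compatible_some p c x u : p \in blanks (rsk c) ->
  compatible (Some p :: c) (x :: u) <->
  [/\ x = 0, p \in blanks u, lattice u & compatible c (insert p u).1].
Proof.
move=> Hp; have pc : p < size c by rewrite -rsk_size; apply: blanks_lt.
have nsc : size c \in blanks (rsk c) = false by rewrite -rsk_size blanks_size_notin.
split=> [[[su] [px lu] H]|[x0 pu lu [su _ H]]].
  have x0 : x = 0.
    have := H (size c) (ltnSn _); rewrite mem_blanks_rsk_some // nsc /=.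
    by case: (x =P 0) => // _; rewrite -su blanks_size_notin.
  have Hu q : q < size c -> (q \in blanks u) = (q \notin blanks (rsk c)) || (q == p).
    move=> qc; have := H q (ltnW qc); rewrite mem_blanks_rsk_some // x0 /= inE su.
    by have -> : (q == size c) = false by [lia]; move=> /= ->; rewrite negb_and negbK.
  have pu : p \in blanks u by rewrite Hu // eqxx orbT.
  split=> //; split; [by rewrite insert_size | exact: lattice_insert |].
  move=> q qc; rewrite mem_blanks_insert // Hu //.
  by case: (q =P p) => [->|]; rewrite ?Hp ?andbT ?orbF.
rewrite insert_size in su; split=> /=; first by rewrite su.
  split=> // r r0; rewrite x0 !cnt_cons; have := lattice_part lu r0; lia.
move=> q; rewrite -/(rsk (Some p :: c)) mem_blanks_rsk_some // x0 /= inE su ltnS.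
rewrite leq_eqVlt => /orP[/eqP->|qc]; first by rewrite eqxx nsc.
have -> : (q == size c) = false by lia.
have := H q qc; rewrite mem_blanks_insert //=.
by case: (q =P p) => [->|_]; rewrite ?pu ?andbF ?andbT.
Qed.

Lemma osc_ofP c u : matching c -> compatible c u ->
  [/\ size (osc_of c u) = (size c).+1, all is_partition (osc_of c u),
      last [::] (osc_of c u) = [::], sorted osc_step (osc_of c u)
    & head [::] (osc_of c u) = diagram u].
Proof.
elim: c u => [|x c IH] u mc; first by case: u => [|y u] [].
case: u => [|y u] cu; first by case: cu.
have lu : lattice (y :: u) by case: cu.
have [pd cd] := diagramP lu.
have H u' : matching c -> compatible c u' -> osc_step (diagram (y :: u)) (diagram u') ->
  let s := diagram (y :: u) :: osc_of c u' in
  [/\ size s = (size c).+2, all is_partition s, last [::] s = [::],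
      sorted osc_step s & head [::] s = diagram (y :: u)].
  move=> mc' cu' st; have [s1 p1 l1 so1 h1] := IH _ mc' cu'.
  split; rewrite //= ?s1 ?p1 ?andbT //; last first.
    by move: s1 so1 h1; case: osc_of => //= a l _ -> ->; rewrite st.
  by move: s1 l1; case: osc_of.
case: x mc cu => [p|] /= => [/andP[Hp mc]|mc] cu.
  have [y0 pu lu' cu'] := (compatible_some y u Hp).1 cu.
  apply: H => //; have lu1 : lattice (insert p u).1 by case: cu'.
  have [pd1 cd1] := diagramP lu1; apply/orP; left.
  apply: (col_len_add_box pd pd1 (insert_gt0 pu)) => q q0.
  by rewrite cd1 // cd // cnt_insert // cnt_cons y0 addnC; lia.
have [y0 cu' pu] := (compatible_none c y u).1 cu.
apply: H => //; have lu1 : lattice u by case: cu'.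
have [pd1 cd1] := diagramP lu1; apply/orP; right.
by apply: (col_len_add_box pd1 pd y0) => q q0; rewrite cd1 // cd.
Qed.

Lemma diagram_cnt u1 u2 r : lattice u1 -> lattice u2 ->
  diagram u1 = diagram u2 -> 0 < r -> cnt u1 r = cnt u2 r.
Proof. by move=> /diagramP[_ c1] /diagramP[_ c2] e r0; rewrite -c1 // e c2. Qed.

(** The tail determines the previous state; the first diagram then tells whether a box was added or
    removed and in which column, and [uninsertK] recovers the point that was closed. *)
Lemma osc_of_inj c1 c2 u1 u2 : matching c1 -> matching c2 ->
  compatible c1 u1 -> compatible c2 u2 -> osc_of c1 u1 = osc_of c2 u2 ->
  c1 = c2 /\ u1 = u2.
Proof.
elim: c1 c2 u1 u2 => [|x1 c1 IH] [|x2 c2] u1 u2 m1 m2 k1 k2.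
- by case: k1 k2 => /size0nil-> _ _ [/size0nil->].
- by case=> _; case: c2 {m2 k2}.
- by case=> _; case: c1 {IH m1 k1}.
case: u1 k1 => [|y1 u1] k1; first by case: k1.
case: u2 k2 => [|y2 u2] k2; first by case: k2.
case=> ed eo.
have l1 : lattice (y1 :: u1) by case: k1.
have l2 : lattice (y2 :: u2) by case: k2.
have ec r := @diagram_cnt _ _ r l1 l2 ed.
case: x1 x2 m1 m2 k1 k2 eo => [p1|] [p2|] /=.
- move=> /andP[H1 m1] /andP[H2 m2] k1 k2.
  have [y10 b1 _ k1'] := (compatible_some y1 u1 H1).1 k1.
  have [y20 b2 _ k2'] := (compatible_some y2 u2 H2).1 k2.
  move=> /IH[] // -> eu.
  have v0 := insert_gt0 b1.
  have ev : (insert p1 u1).2 = (insert p2 u2).2.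
    have := ec _ v0; rewrite !cnt_cons y10 y20.
    have := cnt_insert b1 v0; have := cnt_insert b2 v0; rewrite eu eqxx.
    by case: eqP; lia.
  have := uninsertK b1; rewrite ev eu uninsertK // => -[-> ->].
  by rewrite y10 y20.
- move=> /andP[H1 m1] m2 k1 k2.
  have [y10 b1 _ k1'] := (compatible_some y1 u1 H1).1 k1.
  have [y20 k2' _] := (compatible_none c2 y2 u2).1 k2.
  move=> /IH[] // _ eu; have v0 := insert_gt0 b1.
  have := ec _ v0; have := cnt_insert b1 v0.
  by rewrite !cnt_cons y10 eu eqxx; lia.
- move=> m1 /andP[H2 m2] k1 k2.
  have [y20 b2 _ k2'] := (compatible_some y2 u2 H2).1 k2.
  have [y10 k1' _] := (compatible_none c1 y1 u1).1 k1.
  move=> /IH[] // _ eu; have v0 := insert_gt0 b2.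
  have := ec _ v0; have := cnt_insert b2 v0.
  by rewrite !cnt_cons y20 -eu eqxx; lia.
move=> m1 m2 k1 k2.
have [y20 k2' _] := (compatible_none c2 y2 u2).1 k2.
have [y10 k1' _] := (compatible_none c1 y1 u1).1 k1.
move=> /IH[] // -> eu; split=> //; congr cons => //.
by have := ec _ y10; rewrite !cnt_cons eu eqxx; case: eqP; lia.
Qed.

Lemma osc_of_surj s : sorted osc_step s -> all is_partition s ->
  0 < size s -> last [::] s = [::] ->
  exists c u, [/\ matching c, compatible c u & osc_of c u = s].
Proof.
elim: s => [|la s IH] // so /=; case: s so IH => [|mu s] so IH.
  by move=> _ _ /= ->; exists [::], [::]; split=> //.
case/andP => pl ps _ ls.
have [|c [u [mc cu eo]]] := IH _ ps isT ls; first by case/andP: so.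
have lu : lattice u by case: cu.
have [pd cd] := diagramP lu.
have emu : mu = diagram u by have [_ _ _ _] := osc_ofP mc cu; rewrite eo.
case/andP: so => /orP[] /add_box_col_len[r r0 cr] _; last first.
  have cxu : compatible (None :: c) (r :: u).
    apply/compatible_none; split=> // q q0; rewrite !cnt_cons -!cd // -emu -!cr //.
    exact: col_len_part.
  exists (None :: c), (r :: u); split=> //=; rewrite eo; congr cons.
  have [] := @diagramP (r :: u); first by case: cxu.
  move=> pr cdr; apply: col_len_inj => // q q0.
  by rewrite cdr // cnt_cons -cd // -emu cr.
(* The removed box was a corner at the foot of column [r], so label [r] can be un-inserted. *)
have cv : cnt u r.+1 < cnt u r.
  rewrite -!cd // -emu !cr //; have := col_len_part la r0; rewrite eqxx.
  by have -> : (r == r.+1) = false by [lia]; lia.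
have [] := uninsertP lu r0 cv.
case: uninsert => t p /= Hp Hi lt.
have Hpc : p \in blanks (rsk c).
  case: cu => [su _ H].
  have := mem_blanks_insert p Hp; rewrite Hi Hp eqxx /= H ?negbK; first by move/negbFE.
  by rewrite -su; have := blanks_lt Hp; have := insert_size p t; rewrite Hi /= => ->.
have cxu : compatible (Some p :: c) (0 :: t).
  by apply/compatible_some => //; split=> //; rewrite Hi.
exists (Some p :: c), (0 :: t); split=> //; first by rewrite /= Hpc.
rewrite /= Hi eo; congr cons.
have [pt ct] := diagramP lt; apply: col_len_inj => // q q0.
rewrite ct //; have := cr q q0; have := cnt_insert Hp q0.
by rewrite emu cd // Hi /=; lia.
Qed.

(** * The final state that corresponds to a one-row shape *)

Fixpoint crossing_labels (w : seq nat) : seq nat :=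
  if w is x :: w' then
    (if x == 0 then (size (blanks w')).+1 else 0) :: crossing_labels w'
  else [::].

Lemma cnt_crossing_labels w r : 0 < r ->
  cnt (crossing_labels w) r = (r <= size (blanks w)) :> nat.
Proof.
move=> r0; elim: w => [|x w IH] /=; first by rewrite leqn0 gtn_eqF.
by rewrite cnt_cons IH; case: (x =P 0) => _ /=; lia.
Qed.

Lemma compatible_crossing c : compatible c (crossing_labels (rsk c)).
Proof.
set w := rsk c; rewrite /compatible -rsk_size -/w; split.
- by elim: w => //= x w ->.
- elim: w => //= x w IH; split=> // r r0; rewrite -[_ :: _]/(crossing_labels (x :: w)).
  by rewrite !cnt_crossing_labels //; lia.
elim: w => //= x w IH q; have sc : size (crossing_labels w) = size w by elim: (w) => //= ? ? ->.
rewrite ltnS leq_eqVlt => /orP[/eqP->|qw]; case: (x =P 0) => _ /=.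
- by rewrite inE eqxx -{1}sc blanks_size_notin.
- by rewrite inE sc eqxx blanks_size_notin.
- by rewrite inE negb_or IH // (ltn_eqF qw).
by rewrite inE sc IH // (ltn_eqF qw).
Qed.

(** A label that occurs only once must, by the lattice condition, come after its predecessor, so the
    open points carry 1, 2, ... from left to right. *)
Lemma crossing_labels_uniq c u : compatible c u ->
  (forall r, 0 < r -> cnt u r <= 1) -> u = crossing_labels (rsk c).
Proof.
rewrite /compatible -rsk_size; elim: (rsk c) u => [|y w IH] [|x u] [] //= [su] [px lu] H c1.
have c2 r : 0 < r -> cnt u r <= 1.
  by move=> r0; have := c1 r r0; rewrite cnt_cons; lia.
have {}IH : u = crossing_labels w.
  apply: IH => //; split=> // q qw; have := H q (ltnW qw).
  rewrite -/(blanks (x :: u)) -/(blanks (y :: w)) !mem_blanks_cons su (ltn_eqF qw) !andbF /=.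
  by [].
have := H (size w) (ltnSn _).
rewrite -/(blanks (x :: u)) -/(blanks (y :: w)) !mem_blanks_cons su eqxx !andbT.
rewrite blanks_size_notin -su blanks_size_notin !orbF => xy.
congr cons => //; case: (y =P 0) xy => _ /=; last by move/eqP.
move=> /negbT; rewrite -lt0n => x0.
have := c1 x x0; rewrite cnt_cons eqxx IH cnt_crossing_labels //.
have := px x.-1; rewrite !cnt_cons IH prednK // eqxx.
case: (posnP x.-1) => [x1 _|x1 /(_ isT)]; first lia.
rewrite !cnt_crossing_labels //; lia.
Qed.

Lemma one_row_partition m : is_partition (one_row m).
Proof. by case: m. Qed.

Lemma col_len_one_row m r : 0 < r -> col_len (one_row m) r = (r <= m) :> nat.
Proof. by rewrite /col_len /one_row; case: m => [|m] /= r0; lia. Qed.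

Lemma diagram_crossing c :
  diagram (crossing_labels (rsk c)) = one_row (size (blanks (rsk c))).
Proof.
have [_ lu _] := compatible_crossing c; have [pd cd] := diagramP lu.
apply: col_len_inj => // [|r r0]; first exact: one_row_partition.
by rewrite cd // cnt_crossing_labels // col_len_one_row.
Qed.

(** * Growth diagrams and Schensted's theorem *)

(** Local rule of a cell: from the labels [h] of the lower edge and [v] of the left edge to those of
    the upper and the right edge. *)
Definition rule (x : bool) (h v : nat) : nat * nat :=
  if x then (1, 1) else if (h == v) && (0 < h) then (h.+1, v.+1) else (h, v).

Fixpoint column_labels (x : nat -> bool) (v : nat -> nat) (b : nat) : nat :=
  if b is b'.+1 then (rule (x b') (column_labels x v b') (v b')).1 else 0.

Fixpoint vlabel (X : nat -> nat -> bool) (a b : nat) : nat :=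
  if a is a'.+1 then
    (rule (X a' b) (column_labels (X a') (vlabel X a') b) (vlabel X a' b)).2
  else 0.

Definition hlabel X a b := column_labels (X a) (vlabel X a) b.

Lemma vlabelS X a b :
  vlabel X a.+1 b = (rule (X a b) (hlabel X a b) (vlabel X a b)).2.
Proof. by []. Qed.

Lemma hlabelS X a b :
  hlabel X a b.+1 = (rule (X a b) (hlabel X a b) (vlabel X a b)).1.
Proof. by []. Qed.

Arguments vlabel : simpl never.

(** The local rule commutes with exchanging its two labels, so symmetry propagates from cell to
    cell. *)
Lemma hlabel_sym X a b : (forall a b, X a b = X b a) ->
  hlabel X a b = vlabel X b a.
Proof.
move=> sX; have [n] := ubnP (a + b); elim: n a b => // n IH a [|b] // abn.
have e1 : hlabel X a b = vlabel X b a by apply: IH; lia.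
have e2 : hlabel X b a = vlabel X a b by apply: IH; lia.
rewrite hlabelS vlabelS e1 e2 (sX b a) /rule.
case: (X a b) => //; rewrite [vlabel X a b == _]eq_sym.
by case: eqP => [->|] //=; case: ltnP.
Qed.

Definition partial_perm (X : nat -> nat -> bool) : Prop :=
  (forall a b b', X a b -> X a b' -> b = b') /\
  (forall a a' b, X a b -> X a' b -> a = a').

(* The cells where a label [r] becomes [r.+1]; at level 0 these are the points. *)
Definition event X r a b :=
  (X a b || (hlabel X a b == vlabel X a b) && (0 < vlabel X a b))
  && (vlabel X a b == r).

Definition north_west (c d : nat * nat) := (d.1 < c.1) && (c.2 < d.2).

Lemma north_west_trans : transitive north_west.
Proof. by move=> y x z /andP[? ?] /andP[? ?]; rewrite /north_west; lia. Qed.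

Section Grid.
Variables (X : nat -> nat -> bool) (pX : partial_perm X).

Lemma vlabel_pos a b : 0 < vlabel X a b -> exists2 a', a' < a & X a' b.
Proof.
elim: a => // a IH; rewrite vlabelS /rule.
case: (boolP (X a b)) => [Xab _|_]; first by exists a.
case: eqP => [e|_] /= H.
  have /IH[a' la Xa] : 0 < vlabel X a b by case: (posnP (vlabel X a b)) H => [v0|//]; rewrite e v0.
  by exists a' => //; apply: ltnW.
by have [a' la Xa] := IH H; exists a' => //; apply: ltnW.
Qed.

Lemma hlabel_pos a b : 0 < hlabel X a b -> exists2 b', b' < b & X a b'.
Proof.
elim: b => // b IH; rewrite hlabelS /rule.
case: (boolP (X a b)) => [Xab _|_]; first by exists b.
case: eqP => [e|_] /= H.
  have /IH[b' lb Xb] : 0 < hlabel X a b by case: (posnP (hlabel X a b)) H => [v0|//]; rewrite v0.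
  by exists b' => //; apply: ltnW.
by have [b' lb Xb] := IH H; exists b' => //; apply: ltnW.
Qed.

Lemma point_blank a b : X a b -> hlabel X a b = 0 /\ vlabel X a b = 0.
Proof.
case: pX => p1 p2 Xab; split; apply/eqP; rewrite -leqn0 leqNgt; apply/negP.
  by move=> /hlabel_pos[b' lb /(p1 _ _ _ Xab) e]; move: lb; rewrite e ltnn.
by move=> /vlabel_pos[a' la /(p2 _ _ _ Xab) e]; move: la; rewrite e ltnn.
Qed.

Lemma eventP r a b : event X r a b ->
  [/\ hlabel X a b = r, vlabel X a b = r, hlabel X a b.+1 = r.+1 & vlabel X a.+1 b = r.+1].
Proof.
case/andP => H /eqP vr; rewrite hlabelS vlabelS /rule.
case: (boolP (X a b)) H => [/point_blank[h0 v0] _|_ /andP[/eqP e v0]].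
  by rewrite h0 -vr v0.
by rewrite e v0 eqxx /= vr.
Qed.

Lemma event_eq r a b : 0 < r -> hlabel X a b = r -> vlabel X a b = r ->
  event X r a b.
Proof. by move=> r0 hr vr; rewrite /event hr vr eqxx r0 orbT. Qed.

Lemma label_step a b :
  (exists r, event X r a b) \/
  hlabel X a b.+1 = hlabel X a b /\ vlabel X a.+1 b = vlabel X a b.
Proof.
case: (boolP (event X (vlabel X a b) a b)) => [e|]; first by left; exists (vlabel X a b).
rewrite /event eqxx andbT negb_or hlabelS vlabelS /rule => /andP[/negPf-> H]; right.
by case: eqP H => //= ->; case: ltnP.
Qed.

Lemma vlabel_mono a a' b : a <= a' -> vlabel X a b <= vlabel X a' b.
Proof.
elim: a' => [|a' IH]; first by case: a.
rewrite leq_eqVlt => /orP[/eqP->//|/IH H]; apply: leq_trans H _.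
by have [[r /eventP[_ -> _ ->]]|[_ ->]] := label_step a' b.
Qed.

Lemma hlabel_mono a b b' : b <= b' -> hlabel X a b <= hlabel X a b'.
Proof.
elim: b' => [|b' IH]; first by case: b.
rewrite leq_eqVlt => /orP[/eqP->//|/IH H]; apply: leq_trans H _.
by have [[r /eventP[-> _ -> _]]|[-> _]] := label_step a b'.
Qed.

Lemma vlabel_event r a b : r < vlabel X a b -> exists2 a', a' < a & event X r a' b.
Proof.
elim: a => // a IH; have [[q e]|[_ ->]] := label_step a b; last first.
  by move=> /IH[a' la ea]; exists a' => //; apply: ltnW.
have [_ vq _ ->] := eventP e; rewrite ltnS leq_eqVlt => /orP[/eqP->|]; first by exists a.
by rewrite -vq => /IH[a' la ea]; exists a' => //; apply: ltnW.
Qed.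

Lemma hlabel_event r a b : r < hlabel X a b -> exists2 b', b' < b & event X r a b'.
Proof.
elim: b => // b IH; have [[q e]|[-> _]] := label_step a b; last first.
  by move=> /IH[b' lb eb]; exists b' => //; apply: ltnW.
have [hq _ -> _] := eventP e; rewrite ltnS leq_eqVlt => /orP[/eqP->|]; first by exists b.
by rewrite -hq => /IH[b' lb eb]; exists b' => //; apply: ltnW.
Qed.

Variables N n : nat.

Definition events r (c : nat * nat) := [&& event X r c.1 c.2, c.1 < N & c.2 < n].

(** The [r]-event in the row of [c] is chosen if it is weakly to the right of the next event of the
    chain; otherwise an [r]-event in the column of that next event is chosen. The choices again form
    a chain. *)
Lemma event_chain_lower r c s : path north_west c s -> all (events r.+1) (c :: s) ->
  exists d u, [/\ path north_west d u, all (events r) (d :: u), size u = size s,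
    d.1 < c.1 & c.2 <= d.2].
Proof.
elim: s c => [|c' s IH] [t b] /=.
  move=> _ /andP[/and3P[/= e tN bn] _]; have [_ vt _ _] := eventP e.
  have [|a' la ea] := @vlabel_event r t b; first by rewrite vt.
  by exists (a', b), [::]; rewrite /events /= ea bn (ltn_trans la).
case: c' => t' b' /andP[/andP[/= lt lb] ps] /andP[/and3P[/= e tN bn] as'].
have [[s0 v0] [u [pu au su /= ls lv]]] := IH _ ps as'.
case/andP: as' => /and3P[/= e' t'N b'n] _.
have [ht vt _ _] := eventP e; have [ht' vt' _ _] := eventP e'.
have [|a' la ea] := @vlabel_event r t b; first by rewrite vt.
have [ta|ta] := leqP t' a'.
  exists (a', b), ((s0, v0) :: u); split=> //=; last by rewrite su.
    by rewrite pu /north_west /= (leq_trans ls) //= (leq_trans lb).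
  by move: au => /= ->; rewrite /events /= ea bn (ltn_trans la).
have v1 : vlabel X t' b = r.+1.
  have [_ _ _ va] := eventP ea.
  have := vlabel_mono b ta; have := vlabel_mono b (ltnW lt); lia.
have [|x lx ex] := @hlabel_event r t' b'; first by rewrite ht'.
have [_ vx hx _] := eventP ex.
(* Otherwise column [t'] would carry [r.+1] into row [b], meet [r.+1] there and reach row [b'] with
   a label of at least [r.+2]. *)
have bx : b < x.
  rewrite ltnNge leq_eqVlt; apply/negP => /orP[/eqP xb|xb].
    by move: vx; rewrite xb v1; lia.
  have h1 : hlabel X t' b = r.+1.
    by have := hlabel_mono t' xb; have := hlabel_mono t' (ltnW lb); lia.
  have [_ _ h2 _] := eventP (event_eq (ltn0Sn r) h1 v1).
  by have := hlabel_mono t' lb; lia.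
exists (t', x), ((s0, v0) :: u); split=> //=; last exact: ltnW.
- by rewrite pu /north_west /= ls (leq_trans lx).
- by move: au => /= ->; rewrite /events /= ex t'N (ltn_trans lx).
- by rewrite su.
Qed.

(** For consecutive events [(u', a')] and [(u, a)], both labels entering the cell [(u', a)] are at
    least [r.+1]. If one is larger, an event of level [r.+1] precedes in the same row or column; if
    both equal [r.+1], the cell itself is such an event. *)
Lemma event_chain_raise r c s : path north_west c s -> all (events r) (c :: s) ->
  exists u, [/\ sorted north_west u, all (events r.+1) u, size u = size s
    & if u is d :: _ then (d.1 <= c.1) && (c.2 < d.2) else true].
Proof.
elim: s c => [|c' s IH] [u' a'] /=; first by exists [::].
case: c' => u a /andP[/andP[/= lu la] ps] /andP[/and3P[/= e uN an] as'].
have [w [sw aw zw hw]] := IH _ ps as'.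
case/andP: as' => /and3P[/= e1 u1N a1n] _.
have [h0 v0 h1 v1] := eventP e; have [h2 v2 h3 v3] := eventP e1.
suff [t [b [eb ut tu' ab ba]]] : exists t b,
    [/\ event X r.+1 t b, u < t, t <= u', a' < b & b <= a].
  exists ((t, b) :: w); rewrite /= zw aw /events /= eb.
  rewrite (leq_ltn_trans tu') // (leq_ltn_trans ba) // tu' ab; split=> //.
  case: w hw sw {aw zw} => //= d w /andP[/= h4 h5] ->.
  by rewrite /north_west /= (leq_ltn_trans h4) // (leq_ltn_trans ba).
have va := vlabel_mono a lu; have ha := hlabel_mono u' la.
have [vr|vr] := ltnP r.+1 (vlabel X u' a).
  have [t lt et] := vlabel_event vr; exists t, a; split=> //; last exact: ltnW.
  have [_ vt _ _] := eventP et; rewrite ltnNge; apply/negP => /(vlabel_mono a); lia.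
have [hr|hr] := ltnP r.+1 (hlabel X u' a).
  have [b lb eb] := hlabel_event hr; exists u', b; split=> //; last exact: ltnW.
  have [hb _ _ _] := eventP eb; rewrite ltnNge; apply/negP => /(hlabel_mono u'); lia.
by exists u', a; split=> //; apply: event_eq => //; lia.
Qed.

Lemma events0 c : events 0 c = [&& X c.1 c.2, c.1 < N & c.2 < n].
Proof.
rewrite /events /event; case: (boolP (X _ _)) => [/point_blank[_ ->]|_] //=.
by case: posnP => _; rewrite ?andbF.
Qed.

(** Each level down lengthens a chain by one: the additional event lies in the column of the first
    event of the old chain, below it. *)
Lemma event_chains r l :
  (exists s, [/\ sorted north_west s, all (events r) s & size s = l.+1]) <->
  (exists s, [/\ sorted north_west s, all (events 0) s & size s = r + l.+1]).
Proof.
elim: r l => [|r IH] l //; rewrite addSnnS -IH; split=> -[[|c s] [//= ps as' [ss]]].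
  have [d [u [pu /= au su ld lb]]] := event_chain_lower ps as'.
  case: c as' ld lb {ps} => t b /andP[/and3P[/= e tN bn] _] ld lb.
  have [ht _ _ _] := eventP e.
  have [|x lx ex] := @hlabel_event r t b; first by rewrite ht.
  exists ((t, x) :: d :: u); rewrite /= au su ss pu /north_west /= ld (leq_trans lx) //.
  by rewrite /events /= ex tN (ltn_trans lx).
have [u [pu au su _]] := event_chain_raise ps as'.
by exists u; rewrite pu au su ss.
Qed.

(** Schensted's theorem: a label above [r] comes from an event of level [r], which is a chain of
    length one and so amounts to a chain of [r.+1] points. *)
Lemma vlabel_chain r :
  (exists2 b, b < n & r < vlabel X N b) <->
  (exists s, [/\ sorted north_west s,
     all (fun c => [&& X c.1 c.2, c.1 < N & c.2 < n]) s & size s = r.+1]).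
Proof.
have E s : all (fun c => [&& X c.1 c.2, c.1 < N & c.2 < n]) s = all (events 0) s.
  by apply: eq_all => c; rewrite events0.
transitivity (exists s, [/\ sorted north_west s, all (events r) s & size s = 1]); last first.
  rewrite event_chains addn1.
  by split=> -[s [ps as' zs]]; exists s; split=> //; [rewrite E | rewrite -E].
split=> [[b bn /vlabel_event[a aN e]]|[[|[a b] [|? ?]] [//= _ + _]]].
  by exists [:: (a, b)]; rewrite /= /events /= e aN bn.
rewrite andbT => /and3P[/= e aN bn]; exists b => //.
by have [_ _ _ v] := eventP e; have := vlabel_mono b aN; lia.
Qed.

End Grid.

(** * The word of a matching as a symmetric growth diagram *)

Fixpoint rows (f : nat -> nat) (n : nat) : seq nat :=
  if n is n'.+1 then f n' :: rows f n' else [::].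

Lemma size_rows f n : size (rows f n) = n.
Proof. by elim: n => //= n ->. Qed.

Lemma drop_rows f m n : drop m (rows f (n + m)) = rows f n.
Proof. by elim: m => [|m IH]; rewrite ?addn0 ?drop0 // addnS /= IH. Qed.

Lemma all_rows f n h :
  reflect (forall b, b < n -> f b <= h) (all (leq^~ h) (rows f n)).
Proof.
elim: n => [|n IH] /=; first by constructor.
apply: (iffP andP) => [[fn /IH H] b|H]; first by rewrite ltnS leq_eqVlt => /orP[/eqP->//|/H].
by split; [apply: H|apply/IH => b bn; apply: H; apply: ltnW].
Qed.

Lemma rows_column_none X a n : (forall b, b < n -> X a b = false) ->
  hlabel X a n = 0 /\ rows (vlabel X a.+1) n = rows (vlabel X a) n.
Proof.
elim: n => // n IH H; have [|h0 E] := IH; first by move=> b bn; apply: H; apply: ltnW.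
by rewrite /= E hlabelS vlabelS h0 /rule H // andbF.
Qed.

(** Below the point the carried label is 0 and nothing changes; above it the local rule is the
    bumping rule of [insert]. *)
Lemma rows_column_some X a p n : p < n -> vlabel X a p = 0 ->
  (forall b, b < n -> X a b = (b == p)) ->
  insert p (rows (vlabel X a) n) = (rows (vlabel X a.+1) n, hlabel X a n)
  /\ 0 < hlabel X a n.
Proof.
move=> + vp; elim: n => // n IH; rewrite ltnS leq_eqVlt => /orP[/eqP pn|pn] H.
  have [|h0 E] := @rows_column_none X a n.
    by move=> b bn; rewrite H ?ltnS ?(ltnW bn) // pn (ltn_eqF bn).
  by rewrite /= size_rows pn eqxx hlabelS vlabelS E /rule H // pn eqxx.
have [//||E h0] := IH; first by move=> b bn; rewrite H // ltnS ltnW.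
rewrite /= size_rows (ltn_eqF pn) E hlabelS vlabelS /rule H // (gtn_eqF pn) h0 andbT eq_sym.
by case: eqP => [->|_].
Qed.

Fixpoint partner (c : seq (option nat)) (a : nat) : option nat :=
  if c is x :: c' then if a == size c' then x else partner c' a else None.

Definition closes (c : seq (option nat)) (a b : nat) : bool := partner c a == Some b.

Definition points (c : seq (option nat)) (a b : nat) : bool := closes c a b || closes c b a.

Lemma partner_lt c a b : closes c a b -> a < size c.
Proof.
rewrite /closes; elim: c => //= x c IH; have [->//|_ /IH] := eqVneq a (size c); exact: ltnW.
Qed.

Lemma closes_consE x c a b :
  closes (x :: c) a b = if a == size c then x == Some b else closes c a b.
Proof. by rewrite /closes /=; case: (a == size c). Qed.

Lemma closes_cons x c a b : a < size c -> closes (x :: c) a b = closes c a b.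
Proof. by move=> ac; rewrite /closes /= (ltn_eqF ac). Qed.

Lemma closes_size x c b : closes (x :: c) (size c) b = (x == Some b).
Proof. by rewrite /closes /= eqxx. Qed.

Lemma opener_lt c a b : matching c -> closes c a b -> b < size c.
Proof.
elim: c => // x c IH /= /andP[mx mc]; rewrite closes_consE.
case: (a =P size c) => [_|_ /(IH mc) /ltnW //].
case: x mx => // p Hp /eqP[<-]; apply: ltnW.
by rewrite ltnS -rsk_size; apply: blanks_lt.
Qed.

Lemma mem_blanks_rsk c b : matching c ->
  (b \in blanks (rsk c)) <->
  [/\ b < size c, partner c b = None & forall a, closes c a b = false].
Proof.
elim: c => [|x c IH] //= mc; first by split=> // -[].
have {mc} [mx mc] := andP mc; have {IH} := IH mc.
have sc : size c \in blanks (rsk c) = false by rewrite -rsk_size blanks_size_notin.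
case: x mx => [p|_] /=.
  move=> Hp; rewrite -/(rsk (Some p :: c)).
  have -> : blanks (let: (t, v) := insert p (rsk c) in v.+1 :: t)
    = blanks (insert p (rsk c)).1 by case: insert.
  rewrite mem_blanks_insert // => IH.
  have pc : p < size c by rewrite -rsk_size; apply: blanks_lt.
  split=> [/andP[/IH[bc pb nb] bp]|[]].
    split; [exact: ltnW | by rewrite (ltn_eqF bc) |].
    move=> a; rewrite closes_consE; case: (a =P size c) => _; last exact: nb.
    by apply/negP => /eqP[] /esym/eqP; rewrite (negPf bp).
  rewrite ltnS leq_eqVlt => /orP[/eqP->|bc]; first by rewrite eqxx.
  rewrite (ltn_eqF bc) => pb nb; apply/andP; split.
    apply/IH; split=> // a; have [ac|ac] := ltnP a (size c).
      by have := nb a; rewrite closes_cons.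
    by apply/negbTE/negP => /partner_lt; lia.
  by apply/eqP => bp; have := nb (size c); rewrite closes_size bp eqxx.
rewrite inE rsk_size => IH; split=> [/orP[/eqP->|/IH[bc pb nb]]|[]].
- split=> //; first by rewrite eqxx.
  move=> a; rewrite closes_consE; case: (a =P size c) => // _.
  by apply/negbTE/negP => /(opener_lt mc); rewrite ltnn.
- split; [exact: ltnW | by rewrite (ltn_eqF bc) |].
  by move=> a; rewrite closes_consE; case: (a =P size c) => _ //; apply: nb.
rewrite ltnS leq_eqVlt => /orP[->//|bc]; rewrite (ltn_eqF bc) => pb nb; apply/IH.
split=> // a; have [ac|ac] := ltnP a (size c); first by have := nb a; rewrite closes_cons.
by apply/negbTE/negP => /partner_lt; lia.
Qed.

Lemma closesP c a b : matching c -> closes c a b ->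
  [/\ b < a, a < size c, partner c b = None & forall a', closes c a' b -> a' = a].
Proof.
elim: c => //= x c IH /andP[mx mc].
have [->|ac] := eqVneq a (size c).
  rewrite closes_size => /eqP xb; move: mx; rewrite xb => /(mem_blanks_rsk b mc)[bc pb nb].
  split=> //; first by rewrite (ltn_eqF bc).
  move=> a' ; have [//|a'c] := eqVneq a' (size c).
  by rewrite /closes /= (negPf a'c) => /eqP h; have := nb a'; rewrite /closes h eqxx.
move=> h; have {}h : closes c a b by move: h; rewrite /closes /= (negPf ac).
have [ba aS pb ub] := IH mc h; have bc := ltn_trans ba aS.
split=> //; [exact: ltnW | by rewrite (ltn_eqF bc) |].
move=> a'; have [->|a'c] := eqVneq a' (size c); last first.
  by rewrite /closes /= (negPf a'c) => /ub.
rewrite closes_size => /eqP xb; move: mx; rewrite xb => /(mem_blanks_rsk b mc)[_ _ nb].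
by rewrite nb in h.
Qed.

Lemma points_sym c a b : points c a b = points c b a.
Proof. by rewrite /points orbC. Qed.

Lemma points_perm c : matching c -> partial_perm (points c).
Proof.
move=> mc; have H a b b' : points c a b -> points c a b' -> b = b'.
  move=> /orP[h|h] /orP[h'|h'].
  - by move: h h'; rewrite /closes => /eqP-> /eqP[].
  - by have [_ _ pa _] := closesP mc h'; move: h; rewrite /closes pa.
  - by have [_ _ pa _] := closesP mc h; move: h'; rewrite /closes pa.
  - by have [_ _ _ u] := closesP mc h; rewrite (u _ h').
by split=> // a a' b; rewrite ![points _ _ b]points_sym; apply: H.
Qed.

(** The column of the latest position, cut at the diagonal, is an insertion or is empty. By symmetry
    two equal labels meet in the diagonal cell, which yields their successor, or a blank if they are
    0. *)
Lemma rsk_rows c X : matching c -> (forall a b, X a b = X b a) ->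
  (forall a b, a < size c -> b < size c -> X a b = points c a b) ->
  partial_perm X ->
  rsk c = rows (vlabel X (size c)) (size c).
Proof.
move=> + sX + pX; elim: c => //= x c IH /andP[mx mc] HX.
have Xc a b : a < size c -> b < size c -> X a b = points c a b.
  by move=> ac bc; rewrite HX ?ltnS ?(ltnW ac) ?(ltnW bc) // /points !closes_cons.
have {IH} E := IH mc Xc.
have col b : b < size c -> X (size c) b = (x == Some b).
  move=> bc; rewrite HX ?ltnS ?(ltnW bc) // /points closes_size closes_cons //.
  case: (boolP (closes c b _)) => [h|_]; last by rewrite orbF.
  by have [] := closesP mc h; lia.
have diag : X (size c) (size c) = false.
  rewrite HX // /points closes_size orbb; apply/negP => /eqP xs.
  by move: mx; rewrite xs -{1}rsk_size blanks_size_notin.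
have dV : hlabel X (size c) (size c) = vlabel X (size c) (size c) by apply: hlabel_sym.
rewrite vlabelS /rule diag -dV eqxx /=.
case: x mx col {HX} => [p|] mx col.
  have pc : p < size c by rewrite -rsk_size; apply: blanks_lt.
  have [pb nb] : partner c p = None /\ forall a, closes c a p = false.
    by case: ((mem_blanks_rsk p mc).1 mx).
  have vp : vlabel X (size c) p = 0.
    apply/eqP; rewrite -leqn0 leqNgt; apply/negP => /vlabel_pos[a ac].
    by rewrite Xc // /points nb /closes pb.
  have [|E2 h0] := rows_column_some pc vp; first by move=> b bc; rewrite col // eq_sym.
  by rewrite E E2 h0.
have [h0 E2] := @rows_column_none X (size c) (size c) (fun b bc => col b bc).
by rewrite E h0 E2.
Qed.

(** * Nestings and heights *)

(** Closing the open points from left to right makes the added arcs pairwise crossing, as the end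
    shape [(m)] requires, and performs the fills of [fill_first]. *)
Fixpoint close_all (m : nat) (c : seq (option nat)) : seq (option nat) :=
  if m is m'.+1 then
    Some (first_blank (rsk (close_all m' c))) :: close_all m' c
  else c.

Lemma size_close_all m c : size (close_all m c) = size c + m.
Proof. by elim: m => [|m IH] /=; rewrite ?addn0 // IH addnS. Qed.

Lemma blanks_rsk_some p c :
  blanks (rsk (Some p :: c)) = blanks (insert p (rsk c)).1.
Proof. by rewrite /=; case: insert. Qed.

Lemma blanks_eq s t : blanks s =i blanks t -> blanks s = blanks t.
Proof.
by apply: irr_sorted_eq (blanks_sorted s) (blanks_sorted t) => [y x z|x] /=; lia.
Qed.

Lemma drop_insert m p s : p < size s - m ->
  drop m (insert p s).1 = (insert p (drop m s)).1.
Proof.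
elim: s m => [|x s IH] [|m] ps; rewrite ?drop0 //=.
have E : (p == size s) = false by move: ps => /=; lia.
by rewrite E -IH //; case: insert => t v /=; case: eqP.
Qed.

(** The added closers are not blank, so all blanks lie among the first [size c] entries, and on
    these each closing acts as [fill_first]. *)
Lemma close_allP m c : matching c -> m <= size (blanks (rsk c)) ->
  let cx := close_all m c in
  [/\ matching cx, size (blanks (rsk c)) = size (blanks (rsk cx)) + m,
      blanks (rsk cx) = blanks (drop m (rsk cx))
    & drop m (rsk cx) = iter m fill_first (rsk c)].
Proof.
move=> mc; elim: m => [|m IH] bm; first by rewrite /= addn0 drop0.
have [mx sx bx ex] := IH (ltnW bm); rewrite [close_all _ _]/= /= -/(rsk (close_all m c)).
set cx := close_all m c in mx sx bx ex *.
have Hp : first_blank (rsk cx) \in blanks (rsk cx).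
  by apply: first_blank_mem; lia.
have Hd : first_blank (rsk cx) \in blanks (drop m (rsk cx)) by rewrite -bx.
have pd : first_blank (rsk cx) < size (rsk cx) - m by rewrite -size_drop; apply: blanks_lt.
have dE : drop m.+1 (rsk (Some (first_blank (rsk cx)) :: cx))
  = (insert (first_blank (rsk cx)) (drop m (rsk cx))).1.
  by rewrite -drop_insert //=; case: insert.
rewrite -/(rsk (Some (first_blank (rsk cx)) :: cx)) dE blanks_rsk_some.
split; first by rewrite Hp.
- by rewrite sx (size_blanks_insert Hp); lia.
- by apply: blanks_eq => q; rewrite !mem_blanks_insert // bx.
- by rewrite /fill_first -ex /first_blank bx.
Qed.

Lemma partner_close_all m c a : a < size c -> partner (close_all m c) a = partner c a.
Proof.
by move=> ac; elim: m => //= m <-; rewrite size_close_all ltn_eqF //; lia.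
Qed.

Lemma close_all_first m c a b q : matching c -> m <= size (blanks (rsk c)) ->
  size c <= a -> closes (close_all m c) a b -> q \in blanks (rsk (close_all m c)) -> b < q.
Proof.
move=> mc; elim: m => [|m IH] bm ca.
  by move=> /partner_lt /=; lia.
have [mx sx _ _] := close_allP mc (ltnW bm).
have Hp : first_blank (rsk (close_all m c)) \in blanks (rsk (close_all m c)).
  by apply: first_blank_mem; lia.
rewrite [close_all _ _]/= closes_consE blanks_rsk_some mem_blanks_insert //.
case: eqP => [_ /eqP[<-]|_ h] /andP[Hq nq].
  by rewrite ltn_neqAle eq_sym nq first_blank_le.
exact: IH (ltnW bm) ca h Hq.
Qed.

(** Each added closer takes the leftmost open point, so a later closer takes one further right. *)
Lemma close_all_crossing m c a b a' b' : matching c -> m <= size (blanks (rsk c)) ->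
  size c <= a -> a < a' -> closes (close_all m c) a b -> closes (close_all m c) a' b' ->
  b < b'.
Proof.
move=> mc; elim: m => [|m IH] bm ca aa'.
  by move=> /partner_lt /=; lia.
rewrite [close_all _ _]/= !closes_consE.
case: (a =P _) => [e _|na h].
  rewrite gtn_eqF -?e // => /partner_lt; lia.
case: (a' =P _) => [e /eqP[<-]|na' h']; last exact: IH (ltnW bm) ca aa' h h'.
apply: (close_all_first mc (ltnW bm) ca h).
have [mx sx _ _] := close_allP mc (ltnW bm).
by apply: first_blank_mem; lia.
Qed.

Definition arcs c (d : nat * nat) := closes c d.1 d.2.

Definition ones (i : nat) (s : seq nat) : nat := cnt (drop (size s - i) s) 1.

Lemma ones_cons i x s : i <= size s -> ones i (x :: s) = ones i s.
Proof. by move=> iS; rewrite /ones /= subSn. Qed.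

Lemma ones_size s : ones (size s) s = cnt s 1.
Proof. by rewrite /ones subnn drop0. Qed.

Lemma ones_drop i j s : j <= i <= size s -> ones j (drop (size s - i) s) = ones j s.
Proof.
by move=> /andP[ji iS]; rewrite /ones size_drop drop_drop; congr (cnt (drop _ _) _); lia.
Qed.

(** The new 1 at [p] bumps the next 1 to its right, if any; the number of labels 1 grows only when
    there is none. *)
Lemma ones_insert_full p s : p \in blanks s ->
  [/\ ones p s <= cnt s 1, cnt (insert p s).1 1 = maxn (cnt s 1) (ones p s).+1
    & ((insert p s).2 == 1) = (cnt s 1 == ones p s)].
Proof.
elim: s => [|x s IH] // /blanksP[[-> ->]|[Hp ps E]].
  by rewrite /= eqxx ones_cons // ones_size !cnt_cons /=; split=> //; lia.
have [h1 h2 h3] := IH Hp; have v0 := insert_gt0 Hp.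
rewrite /= E ones_cons; last exact: ltnW.
rewrite cnt_cons; move: h2 h3 v0; case: insert => t v /= h2 h3 v0.
case: (x =P v) => [->|xv] /=; rewrite !cnt_cons h2; split; lia.
Qed.

Lemma mem_blanks_drop i s b : i <= size s ->
  (b \in blanks (drop (size s - i) s)) = (b \in blanks s) && (b < i).
Proof.
elim: s => [|x s IH] //=; rewrite leq_eqVlt => /orP[/eqP->|]; last first.
  rewrite ltnS => iS; rewrite subSn //= IH // -/(blanks (x :: s)) mem_blanks_cons.
  case: (b =P size s) => [->|_]; last by rewrite andbF.
  by rewrite (leq_gtF iS) !andbF.
rewrite subnn -/(blanks (x :: s)); case: (boolP (b \in _)) => //.
by move/blanks_lt => /= ->.
Qed.

Lemma drop_insert_le p i s : p \in blanks s -> i <= p ->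
  drop (size s - i) (insert p s).1 = drop (size s - i) s.
Proof.
elim: s => [|x s IH] // /blanksP[[-> ->]|[Hp ps E]] ip /=.
  by rewrite eqxx subSn.
have iS : i <= size s by apply: leq_trans ip (ltnW ps).
by rewrite E subSn //= -IH //; case: insert => t v /=; case: eqP.
Qed.

Lemma ones_insert i p s : p \in blanks s -> i <= size s ->
  ones i (insert p s).1 =
  if p < i then maxn (ones i s) (ones p s).+1 else ones i s.
Proof.
move=> Hp iS; rewrite {1}/ones insert_size; have [ip|pi] := leqP i p.
  by rewrite drop_insert_le.
have Hd : p \in blanks (drop (size s - i) s) by rewrite mem_blanks_drop // Hp pi.
rewrite drop_insert; last lia.
by have [_ -> _] := ones_insert_full Hd; rewrite ones_drop // (ltnW pi).
Qed.

Lemma drop_crossing_labels d w :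
  drop d (crossing_labels w) = crossing_labels (drop d w).
Proof. by elim: w d => [|x w IH] [|d] //=. Qed.

Lemma north_west_rcons s z : sorted north_west (rcons s z) = all (north_west^~ z) s && sorted north_west s.
Proof. by rewrite !(sorted_pairwise north_west_trans) pairwise_rcons andbC. Qed.

(** * Nestings of the completed matching *)

Section Extended.
Variables (c : seq (option nat)) (mc : matching c).
Let m := size (blanks (rsk c)).
Let n := size c.
Let cx := close_all m c.

Lemma closed_matching : matching cx.
Proof. by have [] := close_allP mc (leqnn m). Qed.

Lemma closed_size : size cx = n + m.
Proof. exact: size_close_all. Qed.

Lemma closed_blanks : blanks (rsk cx) = [::].
Proof.
have [_ H _ _] := close_allP mc (leqnn m).
by apply/size0nil/(@addIn m); rewrite add0n -H.
Qed.

Lemma blank_closed b : b \in blanks (rsk c) <->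
  b < n /\ exists2 a, n <= a & closes cx a b.
Proof.
split=> [Hb|[bn [a an h]]].
  have [bn pb nb] := (mem_blanks_rsk b mc).1 Hb; split=> //.
  case: (boolP (has (fun a => closes cx a b) (iota n m))) => [/hasP[a]|/hasPn H].
    by rewrite mem_iota => /andP[an _] h; exists a.
  suff : b \in blanks (rsk cx) by rewrite closed_blanks.
  apply/(mem_blanks_rsk b closed_matching); split.
  - by rewrite closed_size; lia.
  - by rewrite partner_close_all.
  move=> a; have [an|an] := ltnP a n; first by rewrite /closes partner_close_all //; apply: nb.
  have [aN|aN] := ltnP a (n + m); first by apply/negbTE/H; rewrite mem_iota an.
  by apply/negbTE/negP => /partner_lt; rewrite closed_size; lia.
have [_ _ pb ub] := closesP closed_matching h.
apply/(mem_blanks_rsk b mc); split=> //; first by rewrite -(partner_close_all m bn).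
move=> a'; apply/negP => h'; have a'n := partner_lt h'.
have /ub : closes cx a' b by rewrite /closes partner_close_all.
by move: a'n an; rewrite -/n; lia.
Qed.

Lemma closes_lt a b : closes cx a b -> b < n.
Proof.
move=> h; have [an|an] := ltnP a n.
  have h' : closes c a b by move: h; rewrite /closes partner_close_all.
  by have [ba _ _ _] := closesP mc h'; apply: ltn_trans an.
elim: m @cx (leqnn m : m <= size (blanks (rsk c))) h => [|k IH] cx' bk; first by move/partner_lt; rewrite -/n; lia.
have [mx sx bx _] := close_allP mc (ltnW bk).
rewrite /cx' /= closes_consE; case: eqP => [_ /eqP[<-]|_]; last exact: IH (ltnW bk).
have := @first_blank_mem (rsk (close_all k c)); rewrite bx => H.
have /H/blanks_lt : 0 < size (blanks (drop k (rsk (close_all k c)))).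
  by rewrite -bx; lia.
by rewrite size_drop rsk_size size_close_all -/n; lia.
Qed.

(* A long chain of points of the symmetric matrix has half of its points on one
   side of the diagonal; conversely a nesting can be reflected, except for its
   outermost closes, whose mirror image may lie above row [n]. *)
Lemma chain_nesting k :
  (exists s, [/\ sorted north_west s,
     all (fun d => [&& points cx d.1 d.2, d.1 < n + m & d.2 < n]) s & size s = (2 * k).+1]) <->
  (exists s, [/\ sorted north_west s, all (arcs cx) s & size s = k.+1]).
Proof.
have mx := closed_matching.
pose swap (d : nat * nat) := (d.2, d.1).
have nwS x y : north_west (swap x) (swap y) = north_west y x by rewrite /north_west /= andbC.
have revS s : sorted north_west (map swap (rev s)) = sorted north_west s.
  rewrite sorted_map rev_sorted; case: s => //= d s.
  by apply: eq_path => x y /=; rewrite nwS.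
split=> [[s [ss /allP as' zs]]|[[|d s] [//= ss as' [zs]]]].
  have take_ok t : sorted north_west t -> all (arcs cx) t -> k < size t ->
      exists s, [/\ sorted north_west s, all (arcs cx) s & size s = k.+1].
    move=> st at' kt; exists (take k.+1 t); rewrite take_sorted // size_takel //; split=> //.
    by apply/allP => d /mem_take; apply: (allP at').
  have sz := count_predC (arcs cx) s; rewrite -!size_filter zs in sz.
  have [kl|kl] := ltnP k (size (filter (arcs cx) s)).
    by apply: take_ok kl; [apply: sorted_filter north_west_trans _ _ ss | apply: filter_all].
  apply: (take_ok (map swap (rev (filter (predC (arcs cx)) s)))).
  - by rewrite revS; apply: sorted_filter north_west_trans _ _ ss.
  - apply/allP => x /mapP[y]; rewrite mem_rev mem_filter /= => /andP[ny /as' /and3P[py _ _]] ->.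
    by move: py ny; rewrite /points /arcs => /orP[->|].
  - by rewrite size_map size_rev; lia.
exists ((d :: s) ++ map swap (rev s)).
have [/= ad as1] := andP as'; have {}ad : closes cx d.1 d.2 := ad.
(* Arcs with closers from [n] on cross pairwise, so in a nesting only the outermost arc [d] can
   close there. *)
have below x : x \in s -> x.1 < n.
  move=> xs; rewrite ltnNge; apply/negP => nx.
  have := order_path_min north_west_trans ss => /allP/(_ _ xs) /andP[h1 h2].
  have hx : closes cx x.1 x.2 := allP as1 _ xs.
  have h3 := close_all_crossing mc (leqnn m) nx h1 hx ad.
  by move: h2; rewrite ltnNge ltnW.
split.
- rewrite /= cat_path ss /=; case: (lastP s) ss as1 {as' below zs} => //= t z ss as1.
  rewrite last_rcons rev_rcons /=; apply/andP; split.
    have h : arcs cx z by apply: (allP as1); rewrite mem_rcons mem_head.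
    by have [h1 _ _ _] := closesP mx h; rewrite /north_west /= h1.
  have : sorted north_west (map swap (rev (rcons t z))).
    by rewrite revS; apply: path_sorted ss.
  by rewrite rev_rcons.
- suff /allP : {in (d :: s) ++ map swap (rev s), forall x,
      [&& points cx x.1 x.2, x.1 < n + m & x.2 < n]} by [].
  move=> x; rewrite mem_cat => /orP[] xs.
    have hx : closes cx x.1 x.2.
      by case/predU1P: xs => [->//|/(allP as1)].
    by rewrite /points hx -closed_size (partner_lt hx) (closes_lt hx).
  move/mapP: xs => [y]; rewrite mem_rev => ys ->.
  have hy : closes cx y.1 y.2 := allP as1 _ ys.
  by rewrite /points /= hy orbT below // (ltn_addr _ (closes_lt hy)).
- by rewrite size_cat size_map size_rev /= zs; lia.
Qed.

(** Dropping the entries of the added closers leaves the first [n] rows of the growth diagram of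
    [cx]. *)
Lemma fill_rows :
  iter m fill_first (rsk c) = rows (vlabel (points cx) (n + m)) n.
Proof.
have [mx _ _ <-] := close_allP mc (leqnn m); rewrite -/cx.
rewrite (rsk_rows mx (points_sym cx)) //; last exact: points_perm.
by rewrite closed_size drop_rows.
Qed.

Lemma fill_height k :
  all (leq^~ (2 * k)) (iter m fill_first (rsk c)) <->
  ~ exists s, [/\ sorted north_west s, all (arcs cx) s & size s = k.+1].
Proof.
rewrite fill_rows -chain_nesting -(vlabel_chain (points_perm closed_matching)).
split=> [/all_rows H [b bn]|H]; first by rewrite ltnNge H.
apply/all_rows => b bn; rewrite leqNgt; apply/negP => h; apply: H; by exists b.
Qed.


Definition nesting t i l :=
  exists s, [/\ sorted north_west s,
    all (fun d => [&& closes cx d.1 d.2, t <= d.1 & d.2 < i]) s & size s = l].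

(** Invariant carried back in time. All bounds [i] on the openers are considered because an
    insertion at [p] changes the count of labels 1 according to those before [p]. *)
Definition counts_nestings (c' : seq (option nat)) u :=
  forall i l, i <= size c' -> 0 < l -> l <= ones i u <-> nesting (size c') i l.

(** Arcs closing after the end cross pairwise, so a nesting of them has one arc at most, and the
    label 1 occurs at most once, at the leftmost open point. *)
Lemma counts_crossing : counts_nestings c (crossing_labels (rsk c)).
Proof.
move=> i l iN l0; have sw : size (crossing_labels (rsk c)) = size (rsk c).
  by elim: (rsk c) => //= ? ? ->.
have iw : i <= size (rsk c) by rewrite rsk_size.
rewrite /ones sw drop_crossing_labels cnt_crossing_labels //.
split=> [|[s [ss as' zs]]].
  case: l l0 => [|[|l]] // _; last by case: (0 < _).
  set bl := blanks _; case E : bl => [|b t] // _.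
  have : b \in bl by rewrite E mem_head.
  rewrite mem_blanks_drop // => /andP[/blank_closed[bn [a an h]] bi].
  by exists [:: (a, b)]; rewrite /= h an bi.
case: s ss as' zs => [|d [|e s]]; first by move=> _ _ e; rewrite -e in l0.
  move=> _ /andP[/and3P[h nd di] _] <-.
  have hb : d.2 \in blanks (rsk c) by apply/blank_closed; split; [exact: closes_lt h | exists d.1].
  have : d.2 \in blanks (drop (size (rsk c) - i) (rsk c)) by rewrite mem_blanks_drop // hb.
  by case: blanks.
move=> /= /andP[/andP[h1 h2] _] /and3P[/and3P[hd nd _] /and3P[he ne _] _].
by have h3 := close_all_crossing mc (leqnn m) ne h1 he hd; move: h2; rewrite ltnNge ltnW.
Qed.

Lemma counts_none c' y u : size u = size c' -> partner cx (size c') = None ->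
  counts_nestings (None :: c') (y :: u) -> counts_nestings c' u.
Proof.
move=> su px H i l ic l0; have := H i l (leqW ic) l0; rewrite ones_cons ?su // => ->.
split=> -[s [ss /allP as' zs]]; exists s; split=> //; apply/allP => d /as' /and3P[h1 h2 h3].
  by rewrite h1 h3 ltnW.
rewrite h1 h3 /= andbT ltn_neqAle h2 andbT; apply/eqP => e.
by move: h1; rewrite /closes -e px.
Qed.

(** Going back over a closer makes its arc available. As the first arc to close it can only be the
    innermost of a nesting, whose other arcs open before [p]; such a nesting has at most
    [(ones p u).+1] arcs, which matches [ones_insert]. *)
Lemma counts_some c' p y u : size u = size c' -> partner cx (size c') = Some p ->
  p \in blanks u ->
  counts_nestings (Some p :: c') (y :: u) -> counts_nestings c' (insert p u).1.
Proof.
move=> su px Hp H i l ic l0; have iu : i <= size u by rewrite su.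
have pu := blanks_lt Hp; have pc : p <= size c' by rewrite -su ltnW.
have Hi l' : 0 < l' -> l' <= ones i u <-> nesting (size c').+1 i l'.
  by move=> l'0; rewrite -(ones_cons y iu); apply: H => //; apply: leqW.
have Hpp l' : 0 < l' -> l' <= ones p u <-> nesting (size c').+1 p l'.
  by move=> l'0; rewrite -(ones_cons y (ltnW pu)); apply: H => //; apply: leqW.
have widen : nesting (size c').+1 i l -> nesting (size c') i l.
  move=> [s [ss /allP as' zs]]; exists s; split=> //; apply/allP => d /as' /and3P[h1 h2 h3].
  by rewrite h1 h3 ltnW.
have -> : l <= ones i (insert p u).1 <->
    l <= ones i u \/ (p < i /\ l.-1 <= ones p u).
  rewrite ones_insert //; case: (ltnP p i) => pi; last by split=> [|[]] //; [left|case].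
  rewrite leq_max; split=> [/orP[|]|[->|[_ h]]]; rewrite ?orbT //; [by left|right|].
    by split=> //; lia.
  by apply/orP; right; lia.
split=> [[/(Hi l l0)/widen //|[pi]]|[s [ss as' zs]]].
  case: l l0 {widen Hi} => [//|[|l]] _ /=.
    move=> _; exists [:: (size c', p)].
    by rewrite /= /closes px eqxx leqnn pi.
  move=> /(Hpp l.+1 isT)[s [ss /allP as' zs]].
  exists (rcons s (size c', p)); rewrite north_west_rcons ss size_rcons zs all_rcons /=.
  split=> //; last first.
    rewrite /closes px eqxx leqnn pi /=; apply/allP => d /as' /and3P[h1 h2 h3].
    by rewrite -/(closes _ _ _) h1 (ltnW h2) (ltn_trans h3).
  by rewrite andbT; apply/allP => d /as' /and3P[h1 h2 h3]; rewrite /north_west /= h2.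
case: (lastP s) ss as' zs => [|t z]; first by move=> _ _ e; rewrite -e in l0.
rewrite north_west_rcons all_rcons size_rcons => /andP[/allP tz st] /andP[/and3P[hz cz zi] at'] zs.
have [ez|nz] := eqVneq z.1 (size c'); last first.
  left; apply/(Hi l l0); exists (rcons t z); rewrite north_west_rcons st size_rcons all_rcons hz zi.
  have cz' : size c' < z.1 by rewrite ltn_neqAle eq_sym nz.
  rewrite cz' andbT /=; split=> //; first exact/allP.
  apply/allP => d dt; have /and3P[h1 h2 h3] := allP at' _ dt.
  by have /andP[h4 _] := tz _ dt; rewrite h1 h3 (ltn_trans cz').
have ep : z.2 = p by move: hz; rewrite /closes ez px => /eqP[].
right; split; first by rewrite -ep.
case: l zs l0 {Hi widen} => // l [zs] _; case: l zs => // l zs.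
apply/(Hpp l.+1 isT); exists t; split=> //; apply/allP => d dt.
have /and3P[h1 h2 h3] := allP at' _ dt; have /andP[h4 h5] := tz _ dt.
by rewrite h1 -ez h4 -ep h5.
Qed.

Lemma osc_height_nesting k c' u : matching c' -> compatible c' u ->
  (forall a, a < size c' -> partner cx a = partner c' a) ->
  counts_nestings c' u ->
  all (fun la => size la <= k) (osc_of c' u) <->
  (forall t, t <= size c' -> ~ nesting t t k.+1).
Proof.
elim: c' u => [|x c' IH] u mc' cu px Q.
  split=> // _ [|] // _ [[|d s] [_ // /andP[/and3P[_ _]]]].
  by rewrite ltn0.
case: u cu Q => [|y u] cu Q; first by case: cu.
have su : size u = size c' by case: cu => -[].
have lu : lattice (y :: u) by case: cu.
have [pd cd] := diagramP lu.
have hd : size (diagram (y :: u)) <= k <-> ~ nesting (size c').+1 (size c').+1 k.+1.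
  rewrite -col_len1 // cd // -ones_size /= su -(Q _ k.+1) //.
  by split=> [h1 h2|/negP]; [move: h2; rewrite ltnNge h1 | rewrite -leqNgt].
have px' a : a < size c' -> partner cx a = partner c' a.
  by move=> ac; rewrite px /= ?(ltn_eqF ac) // ltnW.
have pxs : partner cx (size c') = x by rewrite px //= eqxx.
suff IHu : all (fun la => size la <= k)
    (osc_of c' (if x is Some p then (insert p u).1 else u)) <->
    (forall t, t <= size c' -> ~ nesting t t k.+1).
  split=> [/andP[/hd h /IHu H] t|H].
    by rewrite leq_eqVlt => /orP[/eqP->|/H].
  apply/andP; split; first by apply/hd/H.
  by apply/IHu => t tc; apply: H; apply: leqW.
case: x mc' cu pxs Q {px hd} => [p|] /= => [/andP[Hp mc']|mc'] cu pxs Q.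
  have [_ pu _ cu'] := (compatible_some y u Hp).1 cu.
  by apply: IH => //; apply: counts_some Q.
have [_ cu' _] := (compatible_none c' y u).1 cu.
by apply: IH => //; apply: counts_none Q.
Qed.

Lemma osc_height k :
  all (fun la => size la <= k) (osc_of c (crossing_labels (rsk c))) <->
  all (leq^~ (2 * k)) (iter m fill_first (rsk c)).
Proof.
rewrite fill_height (osc_height_nesting k mc (compatible_crossing c) _ counts_crossing); last first.
  by move=> a; apply: partner_close_all.
split=> [H [s [ss as' zs]]|H t tn [s [ss as' zs]]]; last first.
  apply: H; exists s; split=> //; apply/allP => d ds.
  by have /and3P[] := allP as' _ ds.
case: (lastP s) ss as' zs => // t z; rewrite north_west_rcons all_rcons size_rcons.
move=> /andP[/allP tz st] /andP[hz /allP at'] zs.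
(* With [z] the innermost arc, this time is spanned by every arc of the nesting: the openers are at
   most [z.2], which is below both [n] and [z.1]. *)
apply: (H (minn n z.1) (geq_minl _ _)).
exists (rcons t z); rewrite north_west_rcons st all_rcons size_rcons zs.
have zlt : z.2 < minn n z.1.
  have [h _ _ _] := closesP closed_matching hz.
  by rewrite leq_min (closes_lt hz).
split=> //; first by rewrite andbT; apply/allP.
apply/andP; split; first by rewrite zlt geq_minr !andbT.
apply/allP => d dt; have /andP[h1 h2] := tz _ dt; have hd : closes cx d.1 d.2 := at' _ dt.
by rewrite hd (leq_trans (geq_minr _ _) (ltnW h1)) (ltn_trans h2).
Qed.

End Extended.

(** * The bijection *)

Lemma bijective_sub (T : choiceType) (U : eqType) (A : pred T) (B : pred U)
    (f : T -> U) :
  (forall x, A x -> B (f x)) -> {in A &, injective f} ->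
  (forall y, B y -> exists2 x, A x & f x = y) ->
  exists g : {x | A x} -> {y | B y}, bijective g.
Proof.
move=> fAB finj fsurj.
have ex (y : {y | B y}) : exists x, A x && (f x == val y).
  by case: y => y By; have [x Ax fx] := fsurj y By; exists x; rewrite Ax fx eqxx.
pose g (x : {x | A x}) : {y | B y} := Sub (f (val x)) (fAB _ (valP x)).
have hA y : A (xchoose (ex y)) by case/andP: (xchooseP (ex y)).
pose h (y : {y | B y}) : {x | A x} := Sub (xchoose (ex y)) (hA y).
exists g; exists h => [x|y]; apply: val_inj.
  apply: finj; [exact: valP | exact: valP |].
  by case/andP: (xchooseP (ex (g x))) => _ /eqP.
by case/andP: (xchooseP (ex y)) => _ /eqP.
Qed.

(** The common codes of both sides. The height condition is stated for oscillating tableaux and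
    reaches standard tableaux through [osc_height]. *)
Definition coded (n k m : nat) (c : seq (option nat)) : bool :=
  [&& size c == n, matching c, size (blanks (rsk c)) == m &
      all (fun la => size la <= k) (osc_of c (crossing_labels (rsk c)))].

Lemma size_blanks s : size (blanks s) = count_mem 0 s.
Proof. by elim: s => //= x s <-; case: (x == 0). Qed.

(** [osc_of] lists the last shape first, hence the reversals; the step relation is symmetric. *)
Lemma osc_bijection n k m :
  exists f : {c | coded n k m c} -> oscillating_tableaux n k m, bijective f.
Proof.
have symP s : sorted osc_step (rev s) = sorted osc_step s.
  rewrite rev_sorted; case: s => //= la s.
  by apply: eq_path => x y; rewrite /osc_step orbC.
have lastE (s : seq (seq nat)) : last [::] (rev s) = head [::] s.
  by case: s => //= la s; rewrite rev_cons last_rcons.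
apply: (bijective_sub (f := fun c => rev (osc_of c (crossing_labels (rsk c))))).
- move=> c /and4P[/eqP sc mc /eqP sb hc].
  have [sz pt ls so hd] := osc_ofP mc (compatible_crossing c).
  rewrite /is_oscillating_tableau /osc_height_le size_rev sz sc eqxx !all_rev pt symP so hc.
  by rewrite lastE hd diagram_crossing sb eqxx -lastE revK ls eqxx.
- move=> c1 c2 /and4P[_ m1 _ _] /and4P[_ m2 _ _] /(can_inj revK).
  by case/(osc_of_inj m1 m2 (compatible_crossing c1) (compatible_crossing c2)).
move=> s /and3P[/and4P[/eqP sz pt hd so] hk /eqP ls].
have {}hk : all (fun la => size la <= k) s := hk.
have [||||c [u [mc cu eo]]] := @osc_of_surj (rev s).
- by rewrite symP.
- by rewrite all_rev.
- by rewrite size_rev sz.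
- by rewrite lastE; apply/eqP.
have [zo _ _ _ ho] := osc_ofP mc cu.
have lu : lattice u by case: cu.
have du : diagram u = one_row m by rewrite -ho eo -lastE revK.
have cu1 r : 0 < r -> cnt u r = (r <= m) :> nat.
  by move=> r0; have [_ <-] := diagramP lu; rewrite // du col_len_one_row.
(* The columns of the end shape have length at most 1, so each label occurs at most once and the
   final state is forced. *)
have eu : u = crossing_labels (rsk c).
  by apply: crossing_labels_uniq => // r r0; rewrite cu1 // leq_b1.
exists c; last by rewrite -eu eo revK.
rewrite /coded mc -eu eo all_rev hk andbT -eqSS -zo eo size_rev sz eqxx /=.
apply/eqP; have b r : 0 < r -> (r <= size (blanks (rsk c))) = (r <= m).
  by move=> r0; have := cu1 r r0; rewrite {1}eu cnt_crossing_labels //; do 2!case: (_ <= _).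
apply/eqP; rewrite eqn_leq; apply/andP; split.
  by case: (posnP (size (blanks (rsk c)))) => [->//|/b <-].
by case: (posnP m) => [->//|/b ->].
Qed.

Lemma tableaux_bijection n k m :
  exists f : {c | coded n k m c} -> standard_tableaux n (2 * k) m, bijective f.
Proof.
have fillP c : coded n k m c -> let y := iter m fill_first (rsk c) in
  [/\ lattice y /\ 0 \notin y, odd_cols y = m, size y = n,
      num_rows y <= 2 * k & iter m empty_first y = rsk c].
  move=> /and4P[/eqP sc mc /eqP sb hk]; have [lr er] := rsk_lattice mc.
  have sr : strip_ready (rsk c) by move=> r ro; rewrite er // ltnn.
  have [|ly _ oy by_ ky] := iter_fill_firstK (m := m) lr sr; first by rewrite sb.
  split=> //.
  - by split=> //; apply/count_memPn; rewrite -size_blanks; lia.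
  - by rewrite oy (odd_cols_eq0 lr).2.
  - by elim: (m) => [|i IH] /=; rewrite ?rsk_size ?insert_size.
  - by rewrite num_rows_leq -{1}sb; apply/osc_height.
apply: (bijective_sub (f := fun c => tableau (iter m fill_first (rsk c)))).
- move=> c /fillP /= [[ly y0] oy sy ny _].
  rewrite -{1}sy tableau_standard // odd_columns_tableau // oy eqxx andbT.
  by rewrite /height size_map size_mkseq.
- move=> c1 c2 h1 h2 e.
  have /= [[l1 z1] _ s1 _ k1] := fillP _ h1; have /= [[l2 z2] _ s2 _ k2] := fillP _ h2.
  case/and4P: h1 => _ m1 _ _; case/and4P: h2 => _ m2 _ _; apply: rsk_inj => //.
  by rewrite -k1 -k2 -(tableauK l1 z1) -(tableauK l2 z2) s1 s2 e.
move=> T /and3P[sT hT /eqP oT]; have [ly y0 tK] := word_lattice sT.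
set y := word T n in ly y0 tK.
have oy : odd_cols y = m by rewrite -odd_columns_tableau // tK.
have by0 : blanks y = [::] by apply: size0nil; rewrite size_blanks; apply/count_memPn.
have uy : unstrip_ready y by move=> r q _ _; rewrite by0.
(* The word of a standard tableau has no blanks. Undoing [m] fills removes all odd columns and
   leaves [m] blanks, so the result is the word of a matching with [m] open points. *)
have [|lw _ ow bw kw] := iter_empty_firstK (m := m) ly uy; first by rewrite oy.
set w := iter m empty_first y in lw ow bw kw.
have ew : even_columns w by apply/(odd_cols_eq0 lw); lia.
have [c mc ec] := rsk_surj lw ew.
have bc : size (blanks (rsk c)) = m by rewrite ec bw by0.
exists c; last by rewrite ec kw.
rewrite /coded mc bc eqxx /=; apply/andP; split.
  have sf i s : size (iter i fill_first s) = size s.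
    by elim: i => //= i; rewrite insert_size.
  by rewrite -rsk_size ec -(sf m) kw size_word.
apply/osc_height => //; rewrite bc ec kw -num_rows_leq.
by move: hT; rewrite /height size_map -tK size_mkseq.
Qed.

Theorem theorem1 (n k m : nat) (hn : 1 <= n) (hk : 1 <= k) :
  exists f : oscillating_tableaux n k m -> standard_tableaux n (2 * k) m,
    bijective f.
Proof.
have [f [f' fK f'K]] := osc_bijection n k m.
have [g gb] := tableaux_bijection n k m.
by exists (g \o f'); apply: bij_comp gb _; exists f.
Qed.
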